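(* For $n\ge3$ let $\gamma_n$ be the random variable with $\mathbb{P}(\gamma_n=k)=g_k(W_n)/\Gamma_{W_n}(1)$ for $k\ge0$ (the genus of a uniformly random orientable embedding of the wheel graph $W_n$). Then the genus distributions of $(W_n)_{n\ge3}$ are asymptotically normal, i.e. $$\frac{\gamma_n-\mathbb{E}[\gamma_n]}{\sqrt{\operatorname{Var}(\gamma_n)}}\ \xrightarrow{d}\ \mathcal{N}(0,1)\qquad (n\to\infty),$$ and the mean and variance satisfy $\mathbb{E}[\gamma_n]\sim \frac n2$ and $\operatorname{Var}(\gamma_n)\sim\frac14\ln n$ as $n\to\infty$.
   Context: The wheel graph $W_n$ ($n\ge3$) is obtained from the cycle $C_n$ by adding one new vertex and joining it to all vertices of $C_n$. Genus polynomial: surfaces are closed orientable; $\mathbb{S}_k$ is the orientable surface of genus $k$. An embedding of a connected graph $G$ on a surface $S$ is a homeomorphism $h$ of $G$ onto a subset $h(G)$ of $S$ such that every component of $S-h(G)$ is a 2-cell. Two embeddings $h,g:G\to S$ are equivalent if there is an orientation-preserving homeomorphism $f:S\to S$ with $f\circ h=g$. Let $g_k(G)$ be the number of equivalence classes of embeddings of $G$ on $\mathbb{S}_k$, and $\Gamma_G(x)=\sum_{k\ge0}g_k(G)x^k$. Equivalently (standard fact), $g_k(G)$ is the number of rotation systems of the labelled graph $G$ (a choice, at each vertex, of a cyclic permutation of the edge-ends at that vertex) whose face count $f$ obtained by face tracing satisfies $|V(G)|-|E(G)|+f=2-2k$. $X_n\xrightarrow{d}X$ denotes convergence in distribution: the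 cumulative distribution functions $F_{X_n}(x)\to F_X(x)$ at every continuity point $x$ of $F_X$. $\mathcal{N}(0,1)$ is the standard normal distribution. $a_n\sim b_n$ means $a_n/b_n\to1$. *)

(* Defs.v *)
From HB Require Import structures.
From mathcomp Require Import all_boot all_order all_algebra all_fingroup.
From mathcomp Require Import all_classical all_reals all_analysis.
From mathcomp Require Import measurable_realfun zify.

Set Implicit Arguments.
Unset Strict Implicit.
Unset Printing Implicit Defensive.

Import Order.TTheory GRing.Theory Num.Theory.
Import numFieldNormedType.Exports.

Local Open Scope classical_set_scope.
Local Open Scope ring_scope.

Record sgraph := SGraph {
  vert : finType;
  adj : rel vert;
  adj_sym : symmetric adj;
  adj_irr : irreflexive adj }.

Definition edges (G : sgraph) : {set {set vert G}} :=
  [set [set p.1; p.2] | p : vert G * vert G & adj p.1 p.2]%SET.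

(* The dart (u, v) is the end at u of the edge uv. *)
Definition dart (G : sgraph) : finType :=
  {p : vert G * vert G | adj p.1 p.2}.

Definition dart_tail (G : sgraph) (d : dart G) : vert G := (val d).1.

Lemma dart_rev_subproof (G : sgraph) (d : dart G) :
  adj ((val d).2, (val d).1).1 ((val d).2, (val d).1).2.
Proof. by rewrite /= adj_sym; exact: valP d. Qed.

Definition dart_rev (G : sgraph) (d : dart G) : dart G :=
  Sub ((val d).2, (val d).1) (dart_rev_subproof d).

Lemma dart_revK (G : sgraph) : involutive (@dart_rev G).
Proof. by move=> d; apply: val_inj => /=; case: (val d). Qed.

Definition dart_rev_perm (G : sgraph) : {perm dart G} :=
  perm (inv_inj (@dart_revK G)).

(* A cyclic permutation of the edge-ends at each vertex: the cycles of rho are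
   exactly the sets of darts with a common tail. *)
Definition rotation_systems (G : sgraph) : {set {perm dart G}} :=
  [set rho : {perm dart G} | [forall d : dart G,
     porbit rho d == [set d' | dart_tail d' == dart_tail d]%SET]]%SET.

(* Face tracing: traverse the dart (u, v), then leave v along the dart that
   follows (v, u) in the rotation at v.  Permutations compose left to right. *)
Definition face_perm (G : sgraph) (rho : {perm dart G}) : {perm dart G} :=
  (dart_rev_perm G * rho)%g.

Definition nb_faces (G : sgraph) (rho : {perm dart G}) : nat :=
  #|porbits (face_perm rho)|.

(* Number of embeddings of the labelled graph G in the orientable surface of
   genus k, for G connected with at least one edge (the one-vertex graph has no
   dart, hence no traced face). *)
Definition genus_number (G : sgraph) (k : nat) : nat :=
  #|[set rho in rotation_systems G |
      #|vert G|%:Z - #|edges G|%:Z + (nb_faces rho)%:Z == 2 - 2 * k%:Z]%SET|.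

(* The degree bound loses nothing, see coef_genus_poly. *)
Definition genus_poly (R : nzRingType) (G : sgraph) : {poly R} :=
  \poly_(k < #|edges G| + 2) (genus_number G k)%:R.

Lemma coef_genus_poly (R : nzRingType) (G : sgraph) (k : nat) :
  (genus_poly R G)`_k = (genus_number G k)%:R.
Proof.
rewrite coef_poly; case: ltnP => // le_k.
rewrite /genus_number (_ : [set _ in _ | _]%SET = finset.set0) ?cards0//.
by apply/setP => rho; rewrite !inE; apply/negbTE/negP => /andP[_ /eqP]; lia.
Qed.

Definition cycle_adj (n : nat) : rel 'I_n := fun i j =>
  (i != j) && ((j == i.+1 %% n :> nat)%N || (i == j.+1 %% n :> nat)%N).

Lemma cycle_adj_sym n : symmetric (@cycle_adj n).
Proof. by move=> i j; rewrite /cycle_adj eq_sym orbC. Qed.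

Lemma cycle_adj_irr n : irreflexive (@cycle_adj n).
Proof. by move=> i; rewrite /cycle_adj eqxx. Qed.

(* C_n; used only for n >= 3. *)
Definition cycle_graph (n : nat) : sgraph :=
  SGraph (@cycle_adj_sym n) (@cycle_adj_irr n).

(* None is the new vertex. *)
Definition cone_adj (G : sgraph) : rel (option (vert G)) := fun u v =>
  match u, v with
  | None, None => false
  | Some x, Some y => adj x y
  | _, _ => true
  end.

Lemma cone_adj_sym G : symmetric (@cone_adj G).
Proof. by move=> [x|] [y|] //=; exact: adj_sym. Qed.

Lemma cone_adj_irr G : irreflexive (@cone_adj G).
Proof. by move=> [x|] //=; exact: adj_irr. Qed.

Definition cone (G : sgraph) : sgraph :=
  SGraph (@cone_adj_sym G) (@cone_adj_irr G).

Definition wheel (n : nat) : sgraph := cone (cycle_graph n).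

Section standardize.
Context d (T : measurableType d) (R : realType) (P : probability T R).
Variable X : {RV P >-> R}.

Definition standardize : T -> R := fun t =>
  (X t - fine 'E_P[X]%E) / Num.sqrt (fine 'V_P[X]%E).

Lemma measurable_standardize : measurable_fun [set: T] standardize.
Proof.
apply: measurable_funM; last exact: measurable_cst.
by apply: measurable_funB; [exact: measurable_funPT | exact: measurable_cst].
Qed.

HB.instance Definition _ :=
  @isMeasurableFun.Build _ _ T R standardize measurable_standardize.

Definition standardizeRV : {RV P >-> R} := standardize.
End standardize.

(* The limit is given by its law mu, whose distribution function is
   x |-> mu `]-oo, x]; the X n may live on different probability spaces. *)
Definition cvg_in_distribution (R : realType) (d : nat -> measure_display)
    (T : forall n, measurableType (d n)) (P : forall n, probability (T n) R)
    (X : forall n, {RV (P n) >-> R}) (mu : probability (measurableTypeR R) R) :=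
  let F (x : R) : \bar R := mu (`]-oo, x]%classic : set R) in
  forall x : R, {for x, continuous F} -> cdf (X n) x @[n --> \oo] --> F x.

(* Main.v *)
Require Import Defs.
From HB Require Import structures.
From mathcomp Require Import all_boot all_order all_algebra all_fingroup.
From mathcomp Require Import all_classical all_reals all_analysis.
From mathcomp Require Import measurable_realfun zify ring lra.

(** The genus of an embedding of the wheel is (n + 1 - F) / 2, where F is its
    number of faces, so the theorem is a statement about F.  The reason for it
    is that F behaves like the number K of cycles of a uniform permutation of
    n points, up to a bounded error.  The variable K is a sum of independent
    Bernoulli variables of parameters 1, 1/2, ..., 1/n; its mean and variance
    are both ln n + O(1), and it is asymptotically normal.

    - From faces to cycles.  Fix the rotations at the rim and let only the
      rotation s at the hub vary: it is a uniform full cycle of the n hub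
      darts.  Following faces from hub dart to hub dart gives a permutation t
      of the hub darts, independent of s and with at most two cycles, such
      that F is the number of cycles of t * s, plus 0 or 1 ([shortcut],
      [ncyc_rim], [rim_faces]).

    - From full cycles to uniform permutations.  The generating polynomial of
      the number of cycles of t * s is computed exactly
      ([sum_full_cycle_hook]).  Inclusion-exclusion over the s-stable sets
      detects full cycles; exchanging the two sums leaves the matrix
      coefficients, in the exterior powers of the permutation representation,
      of the central element that is the sum of all X^(cycles of u) u.  On the
      constituents of these representations, which are indexed by hooks, that
      element acts by the scalars [hook n k].  Hence the polynomial is a
      combination of these, with coefficient 1 at k = 0 and at most 4 at the
      others.  The polynomial [hook n 0] is n! times the generating function
      of K.  For k > 0, [hook n k] is a multiple of X - 1 with small
      coefficients: it changes the mean of f by a multiple of the maximum of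
      |f (i + 1) - f i| ([cycle_mean_lip]) and the first two moments by O(1/n)
      and O(1) ([cycle_mean_id], [cycle_mean_sq]).

    - Normal approximation.  The Chen-Stein identity for K
      ([perm_mean_stein]) is confronted with the solution of the Stein
      equation for the test functions max (0, z - x) ([stein_solution]), which
      is explicit in terms of the Mills ratio.  This shows that the mean of
      max (0, z - W), for W the standardized number of faces, tends to its
      value for a normal variable ([face_mean_hinge]).  Difference quotients
      in z of these functions enclose the indicators of half-lines
      ([std_faces_cdf]). *)

Set Implicit Arguments.
Unset Strict Implicit.
Unset Printing Implicit Defensive.
Import Order.TTheory GRing.Theory Num.Theory.
Import numFieldNormedType.Exports.
Local Open Scope classical_set_scope.
Local Open Scope ring_scope.

(** * Counting cycles over symmetric groups *)
Section PermSums.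
Import mathcomp.boot.fintype mathcomp.boot.finset.
Variable D : finType.
Implicit Types (s t g : {perm D}) (A S T H : {set D}) (a b : D).

Definition ncyc s : nat := #|porbits s|.

Lemma porbit_fix s x : s x = x -> forall y, (x \in porbit s y) = (x == y).
Proof.
move=> sx y; rewrite porbit_sym; apply/porbitP/eqP => [[i ->]|->].
  by rewrite permX; elim: i => //= i <-; rewrite sx.
by exists 0%N; rewrite expg0 perm1.
Qed.

Lemma ncyc1 : ncyc 1%g = #|D|.
Proof.
rewrite /ncyc card_imset // => x y /setP/(_ y); rewrite porbit_id porbit_sym.
by rewrite porbit_fix ?perm1 // => /eqP.
Qed.

(** The transposition merges the cycle reduced to a with the cycle of b. *)
Lemma ncyc_tperm_fix s a b : s a = a -> a != b ->
  (ncyc (tperm a b * s)%g).+1 = ncyc s.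
Proof.
move=> sa ab; have := porbits_mul_tperm s a b.
by rewrite /= (porbit_fix sa) ab /= /ncyc addn2 addn1 => -[].
Qed.

(** A permutation of a |: A is obtained from one of A by inserting a in a cycle,
    or by leaving it fixed; b is the preimage of a. *)
Lemma sum_perm_onU1 (V : nmodType) A a (F : {perm D} -> V) : a \notin A ->
  \sum_(s | perm_on (a |: A) s) F s =
  \sum_(b in a |: A) \sum_(s | perm_on A s) F (tperm a b * s)%g.
Proof.
move=> aA; rewrite (partition_big (fun s : {perm D} => (s^-1)%g a) (mem (a |: A))) /=; last first.
  by move=> s sA; rewrite (perm_closed _ (perm_onV sA)) setU11.
apply: eq_bigr => b bA.
rewrite (reindex_inj (mulgI (tperm a b))) /=; apply: eq_bigl => s.
have tU : perm_on (a |: A) (tperm a b).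
  by apply: subset_trans (tperm_on a b) _; apply/subsetP => x /set2P[]->; rewrite ?setU11.
rewrite invMg tpermV permM; apply/andP/idP => [[sU /eqP sb]|sA].
  have sU' : perm_on (a |: A) s.
    by rewrite -[s](mulKg (tperm a b)) tpermV perm_onM.
  have sa : s a = a.
    have sVa : (s^-1)%g a = a by rewrite -[LHS](tpermK a b) sb tpermR.
    by rewrite -{1}sVa permKV.
  apply/subsetP => x; rewrite inE => sx; have := subsetP sU' x; rewrite !inE sx => /(_ isT).
  by case/predU1P => // xa; rewrite xa sa eqxx in sx.
split.
  by apply: perm_onM => //; apply: subset_trans sA (subsetUr _ _).
have sa : (s^-1)%g a = a by apply: out_perm (perm_onV sA) aA.
by rewrite sa tpermL.
Qed.

(** Insert the points of A one at a time.  A new point either stays fixed, which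
    gives a factor X, or is merged by a transposition into the cycle of one of
    the c points inserted before, which gives a factor c and, in the signed sum,
    a minus sign.  The factor X^|A| on the left replaces a division: the points
    of A are fixed by g and account for |A| of its cycles. *)
Lemma sum_sym_pow (R : comNzRingType) (eps : bool) A g :
  (forall a, a \in A -> g a = a) ->
  'X^#|A| * \sum_(s | perm_on A s) (-1) ^+ (eps && odd_perm s) * 'X^(ncyc (s * g)%g) =
  'X^(ncyc g) * \prod_(c < #|A|) ('X + (-1) ^+ eps * c%:R) :> {poly R}.
Proof.
have [m] := ubnP #|A|; elim: m A => // m IH A /ltnSE Am gA.
have [->|[a aA]] := set_0Vmem A.
  rewrite cards0 expr0 mul1r big_ord0 mulr1 (big_pred1 1%g) => [|s].
    by rewrite odd_perm1 andbF mul1r mul1g.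
  apply/idP/eqP => [s0|->]; last exact: perm_on1.
  by apply: (perm_on_id s0); rewrite cards0.
have DA : A = a |: A :\ a by rewrite setD1K.
have cA : #|A| = #|A :\ a|.+1 by rewrite [LHS](cardsD1 a) aA.
have aN : a \notin A :\ a by rewrite !inE eqxx.
rewrite {2}DA sum_perm_onU1 // exchange_big /= cA big_ord_recr /= mulrA -IH; last 2 first.
- by rewrite -cA.
- by move=> x /setD1P[_]; exact: gA.
rewrite exprS -!mulrA [in RHS]mulr_suml !mulr_sumr; apply: eq_bigr => s sA.
rewrite big_setU1 //= tperm1 mul1g.
have sga : (s * g)%g a = a by rewrite permM (out_perm sA aN) gA.
rewrite (eq_bigr (fun=> (-1) ^+ eps * ((-1) ^+ (eps && odd_perm s) *
                        'X^((ncyc (s * g)%g).-1)))); last first.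
  move=> b bA; have ab : a != b by apply: contraTneq bA => <-.
  rewrite odd_mul_tperm ab /= -(ncyc_tperm_fix sga ab) mulgA /= mulrA; congr (_ * _).
  by case: {IH} eps; case: odd_perm; rewrite /= ?mulr1 ?mul1r ?mulrNN ?mulr1 ?expr1.
have kS : ncyc (s * g)%g = (ncyc (s * g)%g).-1.+1.
  by rewrite prednK // card_gt0; apply/set0Pn; exists (porbit (s * g)%g a); apply: imset_f.
rewrite sumr_const kS exprS /= -[X in _ + X]mulr_natr.
move: ('X^((ncyc (s * g)%g).-1) : {poly R}) ('X^#|A :\ a| : {poly R}) => u v.
move: (#|A :\ a|%:R : {poly R}) ((-1) ^+ (eps && odd_perm s) : {poly R}) => z x.
by move: ((-1) ^+ eps : {poly R}) => y; ring.
Qed.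
End PermSums.

(** * Permutations stabilising a set, and their signs *)
Section Stabilised.
Import mathcomp.boot.fintype mathcomp.boot.finset.
Local Open Scope ring_scope.
Variable D : finType.
Implicit Types (s t g : {perm D}) (A S T H : {set D}) (a b : D).

Lemma stabP S s : reflect (forall x, (s x \in S) = (x \in S)) (s \in ('N(S | 'P))%g).
Proof. exact (@astabsP _ _ (perm_action D) S s). Qed.

Lemma stab_of_sub S s : (forall x, x \in S -> s x \in S) -> s \in ('N(S | 'P))%g.
Proof.
move=> sS; suff E : s @: S = S.
  by apply/stabP => x; rewrite -{1}E (mem_imset _ _ perm_inj).
apply/eqP; rewrite eqEcard card_imset ?leqnn ?andbT //; last exact: perm_inj.
by apply/subsetP => _ /imsetP[x xS ->]; exact: sS.
Qed.

Lemma perm_on_stab S s : perm_on S s -> s \in ('N(S | 'P))%g.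
Proof. by move=> sS; apply/stabP => x; rewrite perm_closed. Qed.

Lemma perm_onC_stab S s : perm_on (~: S) s -> s \in ('N(S | 'P))%g.
Proof. by move=> sS; rewrite -astabsC; exact: perm_on_stab. Qed.

Lemma restr_perm_id S s : perm_on S s -> restr_perm S s = s.
Proof.
move=> sS; apply/permP => x; have [xS|xNS] := boolP (x \in S).
  by rewrite restr_permE // perm_on_stab.
by rewrite (out_perm sS xNS) (out_perm (restr_perm_on S s) xNS).
Qed.

Lemma restr_perm1 S s : perm_on (~: S) s -> restr_perm S s = 1%g.
Proof.
move=> sS; apply/permP => x; rewrite perm1; have [xS|xNS] := boolP (x \in S).
  by rewrite restr_permE ?perm_onC_stab // (out_perm sS) // inE xS.
by rewrite (out_perm (restr_perm_on S s) xNS).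
Qed.

Lemma perm_onS S T s : S \subset T -> perm_on S s -> perm_on T s.
Proof. by move=> ST sS; exact: subset_trans sS ST. Qed.

Lemma restrM S : {in ('N(S | 'P))%g &, forall s t,
  restr_perm S (s * t)%g = (restr_perm S s * restr_perm S t)%g}.
Proof. by move=> s t sS tS; rewrite morphM. Qed.

Lemma odd_restrM S : {in ('N(S | 'P))%g &, forall s t,
  odd_perm (restr_perm S (s * t)%g) = odd_perm (restr_perm S s) (+) odd_perm (restr_perm S t)}.
Proof. by move=> s t sS tS; rewrite morphM // odd_permM. Qed.

Lemma porbit_conj s t x : porbit (s ^ t)%g (t x) = t @: porbit s x.
Proof.
apply/setP => y; apply/porbitP/imsetP => [[i ->]|[z /porbitP[i ->] ->]].
  exists ((s ^+ i)%g x); first exact: mem_porbit.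
  by rewrite -conjXg conjgE !permM permK.
by exists i; rewrite -conjXg conjgE !permM permK.
Qed.

Lemma ncyc_conj s t : ncyc (s ^ t)%g = ncyc s.
Proof.
rewrite /ncyc -[RHS](card_imset _ (imset_inj (@perm_inj _ t))); congr #|pred_of_set _|.
apply/setP => C; apply/imsetP/imsetP => [[x _ ->]|[_ /imsetP[x _ ->] ->]].
  exists (porbit s ((t^-1)%g x)); first exact: imset_f.
  by rewrite -porbit_conj permKV.
by exists (t x); rewrite ?porbit_conj.
Qed.

Definition cyc_in S s : nat := #|[set C in porbits s | C \subset S]|.

Lemma porbit_stab S s x : s \in ('N(S | 'P))%g -> (porbit s x \subset S) = (x \in S).
Proof.
move=> /stabP sS; apply/subsetP/idP => [|xS y /porbitP[i ->]]; first by apply; exact: porbit_id.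
by rewrite permX; elim: i => //= i; rewrite sS.
Qed.

Lemma porbit_meet_stab S s x y : s \in ('N(S | 'P))%g ->
  y \in porbit s x -> (y \in S) = (x \in S).
Proof. by move=> sS; rewrite -!(porbit_stab _ sS) -eq_porbit_mem => /eqP ->. Qed.

Lemma ncyc_restr S s : s \in ('N(S | 'P))%g ->
  ncyc (restr_perm S s) = (cyc_in S s + #|~: S|)%N.
Proof.
move=> sS; have rE x : x \in S -> porbit (restr_perm S s) x = porbit s x.
  move=> xS; apply/setP => y.
  suff E i : ((restr_perm S s) ^+ i)%g x = (s ^+ i)%g x.
    by apply/porbitP/porbitP => -[i ->]; exists i; rewrite E.
  rewrite !permX; elim: i => //= i ->; rewrite restr_permE //.
  by rewrite -permX; have /stabP -> : (s ^+ i)%g \in ('N(S | 'P))%g by rewrite groupX.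
have rN x : x \notin S -> porbit (restr_perm S s) x = [set x].
  move=> xS; apply/setP => y; rewrite inE eq_sym porbit_sym.
  by apply: porbit_fix; exact: out_perm (restr_perm_on S s) xS.
have -> : #|~: S| = #|[set [set x] | x in ~: S]| by rewrite card_imset //; exact: set1_inj.
rewrite -cardsUI /ncyc /cyc_in -[LHS]addn0; congr (_ + _)%N.
  congr #|pred_of_set _|; apply/setP => C; apply/imsetP/setUP => [[x _ ->]|].
    have [xS|xS] := boolP (x \in S); [left|right].
      by rewrite inE rE // imset_f ?porbit_stab.
    by rewrite rN // imset_f // inE.
  case=> [|/imsetP[x xS ->]]; last by exists x; rewrite ?rN // -in_setC.
  rewrite inE => /andP[/imsetP[x _ ->]]; rewrite porbit_stab // => xS.
  by exists x; rewrite ?rE.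
apply/esym/eqP; rewrite cards_eq0; apply/eqP/setP => C; rewrite !inE.
apply/negP => /andP[/andP[_ CS] /imsetP[x xS CE]].
by move: CS; rewrite CE sub1set; apply/negP; rewrite -in_setC.
Qed.

(** A cycle of length l has sign (-1)^(l - 1), so that both sides count the
    cycles inside S modulo two.  The left side is multiplicative in s; the right
    side is what inclusion-exclusion over sets of cycles needs. *)
Lemma sign_restr (R : pzRingType) S s : s \in ('N(S | 'P))%g ->
  (-1) ^+ #|S| * (-1) ^+ odd_perm (restr_perm S s) = (-1) ^+ cyc_in S s :> R.
Proof.
move=> sS; have := ncyc_restr sS; rewrite /ncyc => kE.
rewrite /odd_perm kE -(cardsC S) !oddD -[in LHS](signr_odd _ #|S|) -[in RHS](signr_odd _ (cyc_in S s)).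
by rewrite -signr_addb; congr (_ ^+ nat_of_bool _); do 2 case: (odd _); case: (odd _).
Qed.

End Stabilised.

(** * Inclusion-exclusion over stable sets *)
Section Inclusion.
Import mathcomp.boot.fintype mathcomp.boot.finset.
Local Open Scope ring_scope.
Variable D : finType.
Implicit Types (s t g : {perm D}) (A S T H : {set D}) (a b : D).

Definition stabs H s : {set {set D}} :=
  [set S : {set D} | (S \subset H) && (s \in ('N(S | 'P))%g)].

Lemma in_stabs H s S :
  (S \in stabs H s) = (S \subset H) && (s \in ('N(S | 'P))%g).
Proof. by rewrite in_set. Qed.

Definition toggle C S : {set D} := (S :\: C) :|: (C :\: S).

Lemma in_toggle C S x : (x \in toggle C S) = (x \in C) (+) (x \in S).
Proof. by rewrite !inE; case: (x \in C); case: (x \in S). Qed.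

Lemma toggleK C : involutive (toggle C).
Proof. by move=> S; apply/setP => x; rewrite !in_toggle addKb. Qed.

Lemma cyc_in_toggle S s y : s \in ('N(S | 'P))%g -> y \notin S ->
  cyc_in (toggle (porbit s y) S) s = (cyc_in S s).+1.
Proof.
move=> sS yS; rewrite /cyc_in [RHS](_ : _ = #|porbit s y |: [set C in porbits s | C \subset S]|).
  congr #|pred_of_set _|; apply/setP => C; rewrite !inE.
  apply/andP/orP => [[/imsetP[x _ ->] /subsetP xS]|].
    have := xS _ (porbit_id s x); rewrite in_toggle -eq_porbit_mem.
    by case: eqP => _ /= xS'; [left|right; rewrite imset_f ?porbit_stab].
  have disj z : z \in porbit s y -> z \notin S by move=> zy; rewrite (porbit_meet_stab sS zy).
  case=> [/eqP ->|/andP[CP CS]]; split => //; first by rewrite imset_f.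
    by apply/subsetP => x xy; rewrite in_toggle xy (negbTE (disj _ xy)).
  apply/subsetP => x /(subsetP CS) xS; rewrite in_toggle xS.
  by case: (boolP (x \in porbit s y)) => // /disj; rewrite xS.
by rewrite cardsU1 !inE porbit_stab // (negbTE yS) andbF.
Qed.

Lemma stabs_toggle H s y S : perm_on H s -> y \in H ->
  (toggle (porbit s y) S \in stabs H s) = (S \in stabs H s).
Proof.
move=> sH yH; wlog suff W : S / S \in stabs H s -> toggle (porbit s y) S \in stabs H s.
  by apply/idP/idP => /W //; rewrite toggleK.
rewrite !in_stabs => /andP[SH /stabP sS]; apply/andP; split.
  apply/subsetP => x; rewrite in_toggle; case: (boolP (x \in porbit s y)) => [xy _|_].
    by rewrite (porbit_meet_stab (perm_on_stab sH) xy).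
  exact: (subsetP SH).
apply/stabP => x; rewrite !in_toggle sS -!eq_porbit_mem.
by have := porbit_perm s 1 x; rewrite expg1 => ->.
Qed.

(** Adding the cycle of y to a stable set, or removing it, is an involution that
    reverses the sign. *)
Lemma sum_toggle (R : numDomainType) H s y (Q : pred {set D}) : perm_on H s -> y \in H ->
  (forall S, Q (toggle (porbit s y) S) = Q S) ->
  \sum_(S in stabs H s | Q S) (-1) ^+ cyc_in S s = 0 :> R.
Proof.
move=> sH yH QT; set X := (X in X = _); suff : X = - X by move/esym/eqP; rewrite eqNr => /eqP.
rewrite {1}/X (reindex_inj (can_inj (toggleK (porbit s y)))) /X -sumrN.
apply: eq_big => [S|S]; first by rewrite stabs_toggle // QT.
rewrite stabs_toggle // => /andP[S_st _].
have [yS|yS] := boolP (y \in S); last first.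
  by rewrite cyc_in_toggle ?exprS ?mulN1r //; move: S_st; rewrite in_stabs => /andP[].
have : toggle (porbit s y) S \in stabs H s by rewrite stabs_toggle.
rewrite in_stabs => /andP[_ tS].
have yT : y \notin toggle (porbit s y) S by rewrite in_toggle porbit_id yS.
by have := cyc_in_toggle tS yT; rewrite toggleK => ->; rewrite exprS mulN1r opprK.
Qed.

Lemma cyc_in0 s : cyc_in set0 s = 0%N.
Proof.
apply/eqP; rewrite cards_eq0; apply/eqP/setP => C; rewrite !inE; apply/negP.
case/andP => /imsetP[x _ ->] /subsetP/(_ x); rewrite porbit_id inE.
by move=> /(_ isT).
Qed.

Lemma sum_stabs (R : numDomainType) H s h : perm_on H s -> h \in H ->
  \sum_(S in stabs H s) (-1) ^+ cyc_in S s = 0 :> R.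
Proof.
move=> sH hH; rewrite -[RHS](@sum_toggle R H s h xpredT) //.
by apply: eq_bigl => S; rewrite andbT.
Qed.

(** The stable sets that avoid h are the unions of cycles other than that of h:
    if there is no such cycle only the empty set contributes, and otherwise any
    one of them can be toggled. *)
Lemma sum_stabs_mark (R : numDomainType) H s h : perm_on H s -> h \in H ->
  \sum_(S in stabs H s | h \notin S) (-1) ^+ cyc_in S s = (porbit s h == H)%:R :> R.
Proof.
move=> sH hH; have hsub : porbit s h \subset H by rewrite porbit_stab // perm_on_stab.
case: eqP => [hE|/eqP hN].
  rewrite (big_pred1 set0) ?cyc_in0 // => S; rewrite in_stabs.
  apply/idP/eqP => [/andP[/andP[SH sS] hS]|->]; last first.
    by rewrite sub0set in_set0 andbT; apply/stabP => x; rewrite !in_set0.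
  apply/setP => x; rewrite in_set0; apply/negP => xS.
  by have := subsetP SH x xS; rewrite -hE => /(porbit_meet_stab sS); rewrite xS (negbTE hS).
have /subsetPn[y yH yh] : ~~ (H \subset porbit s h).
  by apply: contra hN => Hs; rewrite eqEsubset hsub.
apply: sum_toggle yH _ => // S; rewrite in_toggle porbit_sym (negbTE yh).
by [].
Qed.

(** A stable set is determined by the cycles it contains. *)
Lemma card_stabs H s : (#|stabs H s| <= 2 ^ cyc_in H s)%N.
Proof.
rewrite -card_powerset; pose f S := [set C in porbits s | C \subset S].
rewrite -(card_in_imset (_ : {in stabs H s &, injective f})).
  apply/subset_leq_card/subsetP => _ /imsetP[S + ->]; rewrite in_stabs => /andP[SH _]; rewrite inE.
  by apply/subsetP => C; rewrite !inE => /andP[-> /= CS]; exact: subset_trans CS SH.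
move=> S T; rewrite !in_stabs => /andP[_ sS] /andP[_ sT] /setP E; apply/setP => x.
by have := E (porbit s x); rewrite !inE imset_f //= !porbit_stab.
Qed.

End Inclusion.

(** * Matrix coefficients on exterior powers *)
Section MatrixCoefficients.
Import mathcomp.boot.fintype mathcomp.boot.finset.
Local Open Scope ring_scope.
Variables (D : finType) (R : numDomainType) (H : {set D}).
Implicit Types (s t g : {perm D}) (A S T : {set D}) (a b : D).

Definition sgr S s : {poly R} := (-1) ^+ odd_perm (restr_perm S s).

Lemma sgrM S : {in ('N(S | 'P))%g &, {morph sgr S : s t / (s * t)%g >-> s * t}}.
Proof. by move=> s t sS tS; rewrite /sgr odd_restrM // signr_addb. Qed.

Lemma sgrV S s : s \in ('N(S | 'P))%g -> sgr S (s^-1)%g = sgr S s.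
Proof. by move=> sS; rewrite /sgr morphV // odd_permV. Qed.

(** The diagonal matrix coefficient, on the k-th exterior power of the
    permutation representation of k + m points, of the sum of all
    X^(ncyc s) s. *)
Definition rising_falling k m : {poly R} :=
  (\prod_(c < k) ('X - c%:R)) * \prod_(c < m) ('X + c%:R).

(** A permutation of H that stabilises S is a permutation of S times one of
    H :\: S; the sign only sees the first factor, which contributes the falling
    factorial, while the second contributes the rising one. *)
Lemma sum_stab_sign S : S \subset H ->
  'X^#|H| * \sum_(s | perm_on H s && (s \in ('N(S | 'P))%g)) sgr S s * 'X^(ncyc s) =
  'X^#|D| * rising_falling #|S| (#|H| - #|S|).
Proof.
move=> SH; pose T := H :\: S.
have cT : #|T| = (#|H| - #|S|)%N by rewrite cardsD (setIidPr SH).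
have TS : T \subset ~: S by apply/subsetP => x; rewrite !inE => /andP[].
have TH : T \subset H by exact: subsetDl.
rewrite (partition_big (restr_perm S) (perm_on S)) /=; last by move=> s _; exact: restr_perm_on.
rewrite (eq_bigr (fun al => \sum_(be | perm_on T be) (-1) ^+ odd_perm al * 'X^(ncyc (al * be)%g))); last first.
  move=> al alS; rewrite (reindex_inj (mulgI al)) /=; apply: eq_big => be.
    apply/idP/idP => [/andP[/andP[abH abS] /eqP rab]|beT].
      have beH : perm_on H be.
        by rewrite -[be](mulKg al) perm_onM // perm_onV // (perm_onS SH).
      have beS : be \in ('N(S | 'P))%g.
        by rewrite -[be](mulKg al) groupM // groupV perm_on_stab.
      have rb : restr_perm S be = 1%g.
        by move: rab; rewrite (restrM (perm_on_stab alS) beS) restr_perm_id // => /(canRL (mulKg _)) ->; rewrite mulVg.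
      apply/subsetP => x; rewrite !inE => bx; apply/andP; split; last first.
        by apply: contraNT bx => xH; rewrite (out_perm beH).
      apply: contraNN bx => xS; have := restr_permE beS xS; rewrite rb perm1 => <-.
      by rewrite eqxx.
    have bC := perm_onS TS beT.
    have [alN beN] := (perm_on_stab alS, perm_onC_stab bC).
    rewrite perm_onM ?(perm_onS SH alS) ?(perm_onS TH beT) // groupM //=.
    by rewrite (restrM alN beN) restr_perm_id // restr_perm1 // mulg1.
  by move=> /andP[_ /eqP ral]; rewrite /sgr ral.
rewrite exchange_big /= -(subnK (subset_leq_card SH)) -cT addnK exprD -mulrA [X in _ * X]mulr_sumr.
rewrite (eq_bigr (fun be => 'X^(ncyc be) * \prod_(c < #|S|) ('X - c%:R))); last first.
  move=> be beT; have /= := @sum_sym_pow D R true S be.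
  rewrite (eq_bigr (fun c : 'I__ => 'X - c%:R)) => [-> //|c _]; last by rewrite mulN1r.
  by move=> a aS; apply: (out_perm beT); rewrite !inE aS.
rewrite -mulr_suml mulrA (eq_bigr (fun be : {perm D} => (-1) ^+ (false && odd_perm be) * 'X^(ncyc (be * 1)%g))).
  rewrite (@sum_sym_pow D R false T 1%g); last by move=> a _; rewrite perm1.
  rewrite ncyc1.
  rewrite /rising_falling -mulrA [X in _ * X]mulrC; congr (_ * (_ * _)).
  by apply: eq_bigr => i _; rewrite mul1r.
by move=> be _; rewrite /= mul1r mulg1.
Qed.

(** Up to sign, the coefficient of the basis vector of S in the image of that of
    its preimage under t, when the sum of all X^(ncyc s) s acts on an exterior
    power. *)
Definition minor S t : {poly R} :=
  \sum_(s | perm_on H s && (s \in ('N(S | 'P))%g)) sgr S s * 'X^(ncyc (t * s)%g).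

Lemma minor_stab S t : S \subset H -> perm_on H t -> t \in ('N(S | 'P))%g ->
  minor S t = sgr S t * \sum_(s | perm_on H s && (s \in ('N(S | 'P))%g)) sgr S s * 'X^(ncyc s).
Proof.
move=> SH tH tS; rewrite /minor (reindex_inj (mulgI (t^-1)%g)) mulr_sumr /=.
apply: eq_big => s.
  by rewrite groupMl ?groupV //; congr (_ && _); apply/idP/idP => sH;
    [rewrite -[s](mulKVg t)|]; rewrite perm_onM ?perm_onV.
move=> /andP[_]; rewrite groupMl ?groupV // => sS.
by rewrite sgrM ?groupV // sgrV // mulKVg mulrA.
Qed.

Lemma stab_witness S t : t \notin ('N(S | 'P))%g -> exists2 x, x \in S & t x \notin S.
Proof.
move=> tS; have /forall_inPn : ~~ [forall x in S, t x \in S].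
  by apply: contra tS => /forall_inP; exact: stab_of_sub.
by [].
Qed.

(** Consider the points a outside S such that t a lies in S.  If there are two of
    them, conjugating t * s by their transposition preserves the number of
    cycles and reverses the sign of the restriction of s to S, so that the sum
    vanishes.  If there is only one, let b in S be such that t b is not in S.
    Then t^-1 * tperm b a stabilises S, and writing s as its product with some
    s' reduces to t * s = tperm b a * s'; as b is in S, a is not, and s'
    stabilises S, this has one cycle less than s'. *)
Lemma minor_nstab S t : S \subset H -> perm_on H t -> t \notin ('N(S | 'P))%g ->
  exists c : R, 'X * minor S t =
   c%:P * \sum_(s | perm_on H s && (s \in ('N(S | 'P))%g)) sgr S s * 'X^(ncyc s).
Proof.
move=> SH tH tS.
have [b bS tbS] := stab_witness tS.
have [c cS] : exists2 x, x \in S & (t^-1)%g x \notin S.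
  by apply: stab_witness; rewrite groupV.
have [a ac] : exists a, (t^-1)%g c = a by eexists.
rewrite ac => aS; have taS : t a \in S by rewrite -ac permKV.
case: (boolP [exists a', [&& a' != a, a' \notin S & t a' \in S]]).
  case/existsP => a' /and3P[aa a'S ta'S].
  exists 0; rewrite polyC0 mul0r; suff : minor S t = - minor S t.
    move/eqP; rewrite -addr_eq0 -mulr2n -mulr_natr mulf_eq0 -polyC_natr polyC_eq0.
    by rewrite pnatr_eq0 orbF => /eqP ->; rewrite mulr0.
  have pC : perm_on (~: S) (tperm a' a).
    by apply: perm_onS (tperm_on _ _); apply/subsetP => x /set2P[]->; rewrite inE.
  have qS : perm_on S (tperm (t a') (t a)).
    by apply: perm_onS (tperm_on _ _); apply/subsetP => x /set2P[]->.
  have inH x : t x \in S -> x \in H by move/(subsetP SH); rewrite perm_closed.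
  have pH : perm_on H (tperm a' a).
    by apply: perm_onS (tperm_on _ _); apply/subsetP => x /set2P[]->; exact: inH.
  pose f s := (tperm (t a') (t a) * s * tperm a' a)%g.
  have fK : involutive f.
    by move=> s; rewrite /f -!mulgA tperm2 mulg1 !mulgA tperm2 mul1g.
  rewrite {1}/minor (reindex_inj (can_inj fK)) /minor -sumrN; apply: eq_big => s.
    have fP s' : perm_on H s' && (s' \in ('N(S | 'P))%g) -> perm_on H (f s') && (f s' \in ('N(S | 'P))%g).
      move=> /andP[sH sS]; rewrite /f !perm_onM //; last exact: perm_onS SH qS.
      by rewrite groupM ?(perm_onC_stab pC) // groupM ?(perm_on_stab qS).
    by apply/idP/idP => /fP //; rewrite fK.
  have [pN qN] := (perm_onC_stab pC, perm_on_stab qS).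
  rewrite {1 2}/f (groupMr _ pN) (groupMl _ qN) => /andP[_ sS].
  rewrite /f sgrM ?groupM // sgrM //.
  rewrite /sgr (restr_perm_id qS) (restr_perm1 pC) odd_perm1 mulr1 odd_tperm.
  rewrite (inj_eq perm_inj) aa expr1 mulN1r mulNr; congr (- (_ * 'X^_)).
  rewrite -[RHS](ncyc_conj _ (tperm a' a)) conjgE tpermV; congr (ncyc _).
  have -> : tperm (t a') (t a) = ((tperm a' a) ^ t)%g by rewrite tpermJ.
  by rewrite conjgE !mulgA mulgV mul1g.
rewrite negb_exists => /forallP uniqa.
have bH : b \in H by exact: (subsetP SH).
have aH : a \in H by rewrite -(perm_closed _ tH) (subsetP SH).
have ab : b != a by apply: contraNneq aS => <-.
have pH : perm_on H (tperm b a).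
  by apply: perm_onS (tperm_on _ _); apply/subsetP => x /set2P[]->.
have uS : (t^-1 * tperm b a)%g \in ('N(S | 'P))%g.
  apply: stab_of_sub => y yS; rewrite permM.
  have [ya|ya] := eqVneq ((t^-1)%g y) a; first by rewrite ya tpermR.
  have yb : (t^-1)%g y != b by apply: contraNneq tbS => <-; rewrite permKV.
  rewrite tpermD 1?eq_sym //; have := uniqa ((t^-1)%g y).
  by rewrite ya permKV yS andbT negbK.
have tbaH : perm_on H (t^-1 * tperm b a)%g by rewrite perm_onM // perm_onV.
exists ((-1) ^+ odd_perm (restr_perm S (t^-1 * tperm b a)%g)).
rewrite /minor (reindex_inj (mulgI (t^-1 * tperm b a)%g)) !mulr_sumr /=.
apply: eq_big => s.
  rewrite groupMl //; congr (_ && _); apply/idP/idP => sH.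
    by rewrite -[s](mulKg (t^-1 * tperm b a)%g) perm_onM // perm_onV.
  by rewrite perm_onM.
move=> /andP[_]; rewrite groupMl // => sS.
rewrite sgrM // -!mulgA mulKVg.
have -> : 'X^(ncyc s) = 'X * 'X^(ncyc (tperm b a * s)%g) :> {poly R}.
  have := porbits_mul_tperm s b a; rewrite /= ab -/(ncyc _) -/(ncyc s).
  have -> : b \notin porbit s a by apply: contraNN aS => /(porbit_meet_stab sS) <-.
  by rewrite addn2 addn1 => -[<-]; rewrite exprS.
rewrite /sgr rmorphXn rmorphN1 -!mulrA mulrCA; congr (_ * _).
by rewrite mulrCA.
Qed.
End MatrixCoefficients.

(** * The content polynomials of hooks *)
Section HookBasis.
Variables (R : numDomainType) (n : nat).

(** The product of the X + c for c the contents of the boxes of the hook with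
    n boxes, k of which lie below the corner. *)
Definition hook k : {poly R} :=
  (\prod_(j < k) ('X - j.+1%:R)) * \prod_(c < n - k) ('X + c%:R).

(** The common part of [hook k] and [hook k.-1]. *)
Let falling_rest k : {poly R} :=
  (\prod_(j < k.-1) ('X - j.+1%:R)) * \prod_(c < n - k) ('X + c%:R).

Lemma rising_falling0 : rising_falling R 0 n = hook 0.
Proof. by rewrite /rising_falling /hook !big_ord0 subn0. Qed.

Lemma rising_fallingS k : (0 < k)%N -> rising_falling R k (n - k) = 'X * falling_rest k.
Proof.
case: k => // k _; rewrite /rising_falling /falling_rest big_ord_recl subr0 mulrA.
by rewrite -mulrA.
Qed.

Lemma hookE k : (0 < k)%N -> hook k = ('X - k%:R) * falling_rest k.
Proof.
case: k => // k _; rewrite /hook /falling_rest big_ord_recr /= mulrA.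
by rewrite [_ * ('X - _)]mulrC.
Qed.

Lemma hook_predE k : (0 < k <= n)%N -> hook k.-1 = ('X + (n - k)%:R) * falling_rest k.
Proof.
case: k => // k /= kn; rewrite /hook /falling_rest /= -(subnSK kn) big_ord_recr /=.
by rewrite mulrA mulrC.
Qed.

(** The k-th exterior power of the permutation representation is the sum of the
    hook representations of indices k and k.-1, so its matrix coefficients are
    combinations of the two corresponding scalars. *)
Lemma rising_falling_hook k : (k <= n)%N ->
  n%:R * rising_falling R k (n - k) = k%:R * hook k.-1 + (n - k)%:R * hook k.
Proof.
case: k => [|k] kn; first by rewrite subn0 rising_falling0 mul0r add0r.
rewrite rising_fallingS // hook_predE // (@hookE k.+1) // natrB //.
by move: (falling_rest _) (n%:R) (_.+1%:R) => u v w; ring.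
Qed.

Lemma hook_diff k : (0 < k <= n)%N ->
  'X * (hook k.-1 - hook k) = n%:R * rising_falling R k (n - k).
Proof.
case/andP => k0 kn; rewrite rising_fallingS // hook_predE ?k0 // (hookE k0) natrB //.
by move: (falling_rest _) (n%:R) (k%:R) => u v w; ring.
Qed.

Lemma hook_root j k : (j < k)%N -> (hook k).[j.+1%:R] = 0.
Proof.
move=> jk; rewrite /hook hornerM horner_prod (bigD1 (Ordinal jk)) //=.
by rewrite hornerD hornerN -polyC_natr hornerC hornerX subrr !mul0r.
Qed.

Lemma hook_neq0 k : (hook k).[k.+1%:R] != 0.
Proof.
rewrite /hook hornerM mulf_neq0 // horner_prod; apply/prodf_neq0 => i _.
  rewrite hornerD hornerN -polyC_natr hornerC hornerX subr_eq0 eqr_nat eqSS.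
  by rewrite gtn_eqF.
by rewrite hornerD -polyC_natr hornerC hornerX -natrD pnatr_eq0.
Qed.

(** The values at 1, 2, ..., n form a triangular matrix with nonzero
    diagonal. *)
Lemma hook_free (z : nat -> R) :
  \sum_(k < n) (z k)%:P * hook k = 0 -> forall k, (k < n)%N -> z k = 0.
Proof.
move=> z0 k; have [m] := ubnP k; elim: m k => // m IH k /ltnSE km kn.
have /(congr1 (fun p => p.[k.+1%:R])) := z0.
rewrite horner0 horner_sum (bigD1 (Ordinal kn)) //= big1 ?addr0.
  by rewrite hornerM hornerC => /eqP; rewrite mulf_eq0 (negbTE (hook_neq0 k)) orbF => /eqP.
move=> i /eqP ik; rewrite hornerM hornerC.
have [ik'|ki|E] := ltngtP i k; last by case: ik; exact: val_inj.
  by rewrite IH ?mul0r // (leq_trans ik').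
by rewrite hook_root ?mulr0.
Qed.

(** In the application below, a k and b k are the total contributions of the
    sets of size k that are, respectively are not, stable under a fixed
    permutation. *)
Variables (a b : nat -> R).
Hypotheses (b0 : b 0%N = 0) (bn : b n = 0).

Let term k : {poly R} :=
  (a k)%:P * (k%:R * hook k.-1 + (n - k)%:R * hook k) + (b k)%:P * (hook k.-1 - hook k).

Lemma sum_mixed_hook (w : nat -> R) :
  \sum_(k < n.+1) (w k)%:P * term k =
  \sum_(k < n) (w k.+1 * (k.+1%:R * a k.+1 + b k.+1) + w k * ((n - k)%:R * a k - b k))%:P * hook k.
Proof.
transitivity (\sum_(k < n.+1) (w k * (k%:R * a k + b k))%:P * hook k.-1 +
              \sum_(k < n.+1) (w k * ((n - k)%:R * a k - b k))%:P * hook k).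
  rewrite -big_split; apply: eq_bigr => k _ /=; rewrite /term.
  rewrite !(polyCD, polyCM, polyCN) -!polyC_natr !rmorph_nat.
  by move: (hook _) (hook _) (w k)%:P (a k)%:P (b k)%:P (_%:R) (_%:R) => *; ring.
rewrite big_ord_recl [X in _ + X]big_ord_recr /= subnn b0 bn !(mul0r, addr0, subr0, mulr0, add0r).
by rewrite -big_split; apply: eq_bigr => k _ /=; rewrite polyCD mulrDl.
Qed.

Hypothesis S0 : \sum_(k < n.+1) term k = 0.

(** By linear independence, the vanishing of the sum of the terms is a recursion
    that determines b from a.  The weighted sum thus only depends on a, which is
    why the off-diagonal contributions never have to be computed. *)
Lemma sum_mixed_hook_weight :
  \sum_(k < n.+1) (n - k)%:R * term k =
  n%:R * \sum_(k < n) (\sum_(j < k.+1) a j)%:P * hook k.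
Proof.
have z0 k : (k < n)%N -> (k.+1%:R * a k.+1 + b k.+1) + ((n - k)%:R * a k - b k) = 0.
  have := @hook_free (fun k => (k.+1%:R * a k.+1 + b k.+1) + ((n - k)%:R * a k - b k)).
  apply; rewrite -[RHS]S0 -[RHS](eq_bigr _ (fun k _ => mul1r _)).
  have := sum_mixed_hook (fun=> 1) => ->; apply: eq_bigr => i _.
  by rewrite !mul1r.
have e k : (k < n)%N -> (n - k)%:R * a k - b k = n%:R * \sum_(j < k.+1) a j.
  elim: k => [|k IH] kn; first by rewrite subn0 b0 subr0 big_ord1.
  rewrite big_ord_recr mulrDr -IH /=; last exact: ltnW.
  have := z0 k (ltnW kn); rewrite !natrB // ?(ltnW kn) //; last exact: ltnW (ltnW kn).
  move: (a k.+1) (a k) (b k) (b k.+1) n%:R => u v x y w; rewrite -(natr1 k).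
  by move: k%:R => m H; apply/eqP; rewrite -subr_eq0 -oppr_eq0 -[X in _ == X]H -subr_eq0; apply/eqP; ring.
transitivity (\sum_(k < n.+1) (n - k)%:R%:P * term k).
  by apply: eq_bigr => k _; rewrite polyC_natr.
rewrite (sum_mixed_hook (fun k => (n - k)%:R)) mulr_sumr; apply: eq_bigr => k _.
rewrite -polyC_natr mulrA -polyCM; congr (_%:P * _).
have := z0 _ (ltn_ord k); rewrite -e // => /eqP; rewrite addr_eq0 => /eqP ->.
move: ((n - k)%:R * a k - b k) => y.
have -> : (n - k)%:R = (n - k.+1)%:R + 1 :> R by rewrite natr1 subnSK.
by rewrite mulrN mulrDl mul1r addKr.
Qed.
End HookBasis.

(** * Cycles of the product of a permutation and a full cycle *)
Section CyclesOfProducts.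
Import mathcomp.boot.fintype mathcomp.boot.finset.
Local Open Scope ring_scope.
Variables (D : finType) (R : numDomainType) (H : {set D}).
Implicit Types (s t g : {perm D}) (A S T : {set D}) (a b : D).

Definition full_cycle s := perm_on H s && [forall h in H, porbit s h == H].

Lemma full_cycle_mark s h : h \in H -> full_cycle s = perm_on H s && (porbit s h == H).
Proof.
move=> hH; apply/andP/andP => -[sH].
  by move/forall_inP/(_ h hH).
move/eqP => E; split => //; apply/forall_inP => x; rewrite -E => xh.
by rewrite eq_porbit_mem.
Qed.

Variable t : {perm D}.
Hypothesis tH : perm_on H t.

Let n := #|H|.
Let G S : {poly R} :=
  \sum_(s | perm_on H s && (s \in ('N(S | 'P))%g)) (-1) ^+ cyc_in S s * 'X^(ncyc (t * s)%g).
Let alpha S : R := (t \in ('N(S | 'P))%g)%:R * (-1) ^+ cyc_in S t.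

Lemma signed_sum_minor S : G S = (-1) ^+ #|S| * minor R H S t.
Proof.
rewrite /G /minor mulr_sumr; apply: eq_bigr => s /andP[_ sS].
by rewrite mulrA /sgr sign_restr.
Qed.

Lemma signed_sum_hook S : S \subset H -> exists beta : R,
  (t \in ('N(S | 'P))%g -> beta = 0) /\
  'X^n * (n%:R * G S) = 'X^#|D| *
   ((alpha S)%:P * (#|S|%:R * hook R n #|S|.-1 + (n - #|S|)%:R * hook R n #|S|) +
    beta%:P * (hook R n #|S|.-1 - hook R n #|S|)).
Proof.
move=> SH; have Sn : (#|S| <= n)%N by exact: subset_leq_card.
have Z := sum_stab_sign R SH; rewrite signed_sum_minor /alpha.
have [tS|tS] := boolP (t \in _).
  exists 0; split => //; rewrite polyC0 mul0r addr0 mul1r.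
  rewrite -rising_falling_hook // minor_stab //.
  rewrite (mulrA ((-1) ^+ _)) /sgr sign_restr // rmorphXn rmorphN1.
  move: Z; rewrite -/n; move: (\sum_(s | _) _) (rising_falling _ _ _) => z v.
  move: ('X^_ : {poly R}) ('X^_ : {poly R}) ((-1) ^+ cyc_in S t : {poly R}) => y x c Z.
  by transitivity (n%:R * c * (x * z)); [|rewrite Z]; ring.
have [c cE] := minor_nstab R SH tH tS.
exists ((-1) ^+ #|S| * c); split => //; rewrite mul0r polyC0 mul0r add0r.
have S0 : (0 < #|S|)%N.
  rewrite card_gt0; apply: contraNneq tS => ->.
  by apply/stabP => x; rewrite !in_set0.
apply: (mulfI (negbT (polyX_eq0 R))).
have := hook_diff R (introT andP (conj S0 Sn)).
move: Z cE; rewrite -/n rmorphM rmorphXn rmorphN1.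
move: (minor _ _ _ _) (rising_falling _ _ _) (hook _ _ _ - _) => u v w.
move: (\sum_(s | _) _) ('X^_ : {poly R}) ('X^_ : {poly R}) => z y x Z cE hE.
transitivity (x * n%:R * (-1) ^+ #|S| * ('X * u)); first by ring.
rewrite cE; transitivity (n%:R * (-1) ^+ #|S| * c%:P * (x * z)); first by ring.
rewrite Z; transitivity ((-1) ^+ #|S| * c%:P * y * (n%:R * v)); first by ring.
by rewrite -hE; ring.
Qed.

Let N : {poly R} := \sum_(s | full_cycle s) 'X^(ncyc (t * s)%g).

Lemma signed_sum_swap (Q : pred {set D}) :
  \sum_(S : {set D} | (S \subset H) && Q S) G S =
  \sum_(s | perm_on H s)
    (\sum_(S in stabs H s | Q S) (-1) ^+ cyc_in S s)%:P * 'X^(ncyc (t * s)%g).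
Proof.
rewrite (exchange_big_dep (perm_on H)) /=; last by move=> S s _ /andP[].
apply: eq_bigr => s sH; rewrite rmorph_sum /= mulr_suml; apply: eq_big => S.
  by rewrite in_stabs sH /= -!andbA; congr (_ && _); rewrite andbC.
by rewrite rmorphXn rmorphN1.
Qed.

Hypothesis H0 : (0 < n)%N.

(** The indicator of full cycles is a signed sum over the stable sets that avoid
    a given point h of H.  Averaging over h gives weight n - |S| to a set S,
    whereas the sum without weights vanishes: these are the two sums related by
    [sum_mixed_hook_weight].  The coefficient e k is the signed number of
    t-stable sets of at most k points. *)
Theorem sum_full_cycle_hook : exists e : nat -> R,
  [/\ e 0%N = 1, forall k, `|e k| <= (2 ^ cyc_in H t)%:R &
   n%:R * 'X^n * N = 'X^#|D| * \sum_(k < n) (e k)%:P * hook R n k].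
Proof.
have [h hH] : exists h, h \in H by apply/set0Pn; rewrite -card_gt0.
have /fin_all_exists[beta bP] : forall S : {set D}, exists b : R, S \subset H ->
    (t \in ('N(S | 'P))%g -> b = 0) /\
  'X^n * (n%:R * G S) = 'X^#|D| *
   ((alpha S)%:P * (#|S|%:R * hook R n #|S|.-1 + (n - #|S|)%:R * hook R n #|S|) +
    b%:P * (hook R n #|S|.-1 - hook R n #|S|)).
  move=> S; have [SH|SH] := boolP (S \subset H); last by exists 0.
  by have [b bP] := signed_sum_hook SH; exists b.
pose a k := \sum_(S : {set D} | (S \subset H) && (#|S| == k)) alpha S.
pose b k := \sum_(S : {set D} | (S \subset H) && (#|S| == k)) beta S.
have b0 : b 0%N = 0.
  rewrite /b big1 // => S /andP[SH]; rewrite cards_eq0 => /eqP S0.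
  have [-> //] := bP S SH; rewrite S0.
  by apply/stabP => x; rewrite !in_set0.
have bn : b n = 0.
  rewrite /b big1 // => S /andP[SH Sn]; have [-> //] := bP S SH.
  suff -> : S = H by exact: perm_on_stab.
  by apply/eqP; rewrite eqEcard SH (eqP Sn) leqnn.
pose tm k := (a k)%:P * (k%:R * hook R n k.-1 + (n - k)%:R * hook R n k)
    + (b k)%:P * (hook R n k.-1 - hook R n k).
have main (w : nat -> {poly R}) :
  'X^n * (n%:R * \sum_(S : {set D} | S \subset H) w #|S| * G S) =
  'X^#|D| * \sum_(k < n.+1) w k * tm k.
  rewrite mulr_sumr mulr_sumr.
  rewrite (partition_big (fun S : {set D} => inord #|S| : 'I_n.+1) xpredT) //=.
  rewrite mulr_sumr; apply: eq_bigr => k _.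
  have kE S : S \subset H -> (inord #|S| == k) = (#|S| == k).
    by move=> SH; rewrite -val_eqE /= inordK // ltnS subset_leq_card.
  rewrite /tm !rmorph_sum /= !mulr_suml -big_split /= !mulr_sumr.
  apply: eq_big => [S|S /andP[SH]]; first by case: (boolP (S \subset H)) => // /kE.
  rewrite kE // => /eqP <-; have [_] := bP S SH.
  move: (G S) ('X^_ : {poly R}) ('X^_ : {poly R}) (w _) => u y x z E.
  transitivity (z * (x * (n%:R * u))); first by ring.
  by rewrite E; ring.
have XD : 'X^#|D| != 0 :> {poly R} by rewrite expf_neq0 // polyX_eq0.
have S0 : \sum_(k < n.+1) tm k = 0.
  apply: (mulfI XD); rewrite mulr0 -[LHS](congr1 _ (eq_bigr _ (fun i _ => mul1r _))).
  rewrite -(main (fun=> 1)) (eq_bigr G) => [|S _]; last by rewrite mul1r.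
  have /= := signed_sum_swap xpredT; under eq_bigl do rewrite andbT.
  move=> ->; rewrite big1 ?mulr0 // => s sH.
  have := @sum_stabs D R _ s h sH hH; under eq_bigl do rewrite andbT.
  by move=> ->; rewrite polyC0 mul0r.
have NE : n%:R * N = \sum_(S : {set D} | S \subset H) (n - #|S|)%:R * G S.
  transitivity (\sum_(x in H) \sum_(S : {set D} | (S \subset H) && (x \notin S)) G S).
    rewrite mulr_natl -sumr_const; apply: eq_bigr => x xH.
    rewrite signed_sum_swap /N (eq_bigl _ _ (fun s => full_cycle_mark s xH)) big_mkcondr /=.
    apply: eq_bigr => s sH; rewrite sum_stabs_mark //.
    by case: eqP => _; rewrite ?polyC1 ?mul1r // polyC0 mul0r.
  rewrite (exchange_big_dep (fun S : {set D} => S \subset H)) /=; last by move=> x S _ /andP[].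
  apply: eq_bigr => S SH; rewrite sumr_const mulr_natl; congr (_ *+ _).
  have <- : #|H :\: S| = (n - #|S|)%N by rewrite cardsD (setIidPr SH).
  by apply: eq_card => x; rewrite unfold_in /= SH in_setD andbC.
exists (fun k => \sum_(j < k.+1) a j); split.
- rewrite big_ord1 /a (big_pred1 set0) => [|S]; last first.
    rewrite cards_eq0; apply/andP/eqP => [[_ /eqP]//|->].
    by rewrite sub0set eqxx.
  rewrite /alpha cyc_in0 mulr1; suff -> : t \in ('N(set0 | 'P))%g by [].
  by apply/stabP => x; rewrite !in_set0.
- move=> k; apply: le_trans (ler_norm_sum _ _ _) _.
  apply: (@le_trans _ _ (\sum_(S in stabs H t) 1)); last first.
    by rewrite sumr_const ler_nat card_stabs.
  apply: (@le_trans _ _ (\sum_(j < k.+1) \sum_(S : {set D} | (S \subset H) && (#|S| == j)) `|alpha S|)).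
    by apply: ler_sum => j _; exact: ler_norm_sum.
  rewrite (exchange_big_dep (fun S : {set D} => S \subset H)) /=; last by move=> j S _ /andP[].
  rewrite [X in _ <= X](eq_bigl (fun S : {set D} => (S \subset H) && (t \in ('N(S | 'P))%g))); last first.
    by move=> S; rewrite in_stabs.
  rewrite [X in _ <= X]big_mkcondr /=; apply: ler_sum => S SH.
  rewrite /alpha normrM normrX normrN1 expr1n mulr1 normr_nat.
  have -> : (if t \in ('N(S | 'P))%g then 1 else 0) = (t \in ('N(S | 'P))%g)%:R :> R by case: ifP.
  have [Sk|Sk] := ltnP #|S| k.+1.
    by rewrite (big_pred1 (Ordinal Sk)) // => j; rewrite SH /= -val_eqE eq_sym.
  rewrite big_pred0 ?ler0n // => j; rewrite SH /= gtn_eqF //.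
  exact: leq_trans (ltn_ord j) Sk.
apply: (mulfI (_ : n%:R != 0)); first by rewrite -polyC_natr polyC_eq0 pnatr_eq0 -lt0n.
have := sum_mixed_hook_weight b0 bn S0; rewrite -/tm => E.
transitivity ('X^n * (n%:R * (n%:R * N))); first by ring.
rewrite NE; have /= := main (fun k => (n - k)%:R) => ->.
by rewrite E; ring.
Qed.
End CyclesOfProducts.

(** * Means read off generating polynomials *)
Section CoefficientFunctional.
Variable R : realFieldType.
Implicit Types (f : nat -> R) (p q : {poly R}) (c : R) (cs : seq R).

Definition coef_sum f p : R := \sum_(i < size p) p`_i * f i.

Lemma coef_sumE f p m : (size p <= m)%N -> coef_sum f p = \sum_(i < m) p`_i * f i.
Proof.
move=> pm; rewrite /coef_sum (big_ord_widen _ (fun i => p`_i * f i) pm) big_mkcond.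
by apply: eq_bigr => i _; case: ltnP => // /(nth_default 0) ->; rewrite mul0r.
Qed.

Lemma coef_sum_is_linear f : linear_for *%R (coef_sum f).
Proof.
move=> c p q; pose m := maxn (size p) (size q).
rewrite (@coef_sumE f p m) ?leq_maxl // (@coef_sumE f q m) ?leq_maxr //.
rewrite (@coef_sumE f _ m); last first.
  by rewrite (leq_trans (size_polyD _ _)) // geq_max leq_maxr (leq_trans (size_scale_leq _ _)) ?leq_maxl.
rewrite mulr_sumr -big_split; apply: eq_bigr => i _ /=.
by rewrite coefD coefZ mulrDl mulrA.
Qed.

HB.instance Definition _ f :=
  GRing.isLinear.Build R {poly R} R _ (coef_sum f) (coef_sum_is_linear f).

Lemma coef_sumC f c p : coef_sum f (c%:P * p) = c * coef_sum f p.
Proof. by rewrite mul_polyC linearZ. Qed.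

Lemma coef_sumXn f k : coef_sum f 'X^k = f k.
Proof.
rewrite (@coef_sumE f _ k.+1) ?size_polyXn // big_ord_recr /= coefXn eqxx mul1r big1 ?add0r //.
by move=> i _; rewrite coefXn ltn_eqF // mul0r.
Qed.

Lemma coef_sum1 f : coef_sum f 1 = f 0%N.
Proof. exact: coef_sumXn f 0. Qed.

Lemma coef_sumX f p : coef_sum f ('X * p) = coef_sum (fun i => f i.+1) p.
Proof.
rewrite (@coef_sumE f _ (size p).+1); last first.
  by rewrite (leq_trans (size_polyMleq _ _)) // size_polyX.
rewrite big_ord_recl coefXM mul0r add0r; apply: eq_bigr => i _.
by rewrite coefXM.
Qed.

Lemma coef_sumXnM f d p : coef_sum f ('X^d * p) = coef_sum (fun i => f (i + d)%N) p.
Proof.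
elim: d f => [|d IH] f.
  by rewrite mul1r; apply: eq_bigr => i _; rewrite addn0.
by rewrite exprS -mulrA coef_sumX IH; apply: eq_bigr => i _; rewrite addnS.
Qed.

Lemma eq_coef_sum f g p : f =1 g -> coef_sum f p = coef_sum g p.
Proof. by move=> fg; apply: eq_bigr => i _; rewrite fg. Qed.

Lemma coef_sum_comb f g c p :
  coef_sum (fun i => f i + c * g i) p = coef_sum f p + c * coef_sum g p.
Proof.
by rewrite /coef_sum mulr_sumr -big_split; apply: eq_bigr => i _ /=; rewrite mulrDr mulrCA.
Qed.

Lemma coef_sum_XD f c p : coef_sum f (('X + c%:P) * p) =
  coef_sum (fun i => f i.+1) p + c * coef_sum f p.
Proof. by rewrite mulrDl linearD /= coef_sumX coef_sumC. Qed.

Lemma coef_sum_const c p : coef_sum (fun=> c) p = p.[1] * c.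
Proof.
by rewrite horner_coef mulr_suml; apply: eq_bigr => i _; rewrite expr1n mulr1.
Qed.

Definition linprod cs : {poly R} := \prod_(c <- cs) ('X + c%:P).

Lemma horner_linprod1 cs : (linprod cs).[1] = \prod_(c <- cs) (1 + c).
Proof. by rewrite horner_prod; apply: eq_bigr => c _; rewrite hornerD hornerX hornerC. Qed.

Lemma coef_sum_linprod_le f M cs : (forall i, `|f i| <= M) ->
  `|coef_sum f (linprod cs)| <= M * \prod_(c <- cs) (1 + `|c|).
Proof.
elim: cs f => [|c cs IH] f fM.
  by rewrite /linprod !big_nil coef_sum1 mulr1.
rewrite /linprod !big_cons -/(linprod cs) coef_sum_XD mulrCA mulrDl mul1r.
rewrite (le_trans (ler_normD _ _)) // lerD ?IH // normrM ler_wpM2l //.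
exact: IH.
Qed.

(** The left side is the derivative at 1, and omitting a factor 1 + c of the value
    at 1 cannot increase its absolute value. *)
Lemma coef_sum_id_linprod_le cs : (forall c, c \in cs -> 1 <= `|1 + c|) ->
  `|coef_sum (fun i => i%:R) (linprod cs)| <= (size cs)%:R * `|(linprod cs).[1]|.
Proof.
rewrite horner_linprod1.
elim: cs => [|c cs IH] cs1; first by rewrite /linprod !big_nil coef_sum1 normr0 mul0r.
have c1 : 1 <= `|1 + c| by rewrite cs1 // mem_head.
rewrite /linprod !big_cons -/(linprod cs) coef_sum_XD.
rewrite (@eq_coef_sum _ (fun i => i%:R + 1 * 1)); last by move=> i; rewrite mulr1 natr1.
rewrite (@coef_sum_comb _ (fun=> 1)) coef_sum_const mulr1 mul1r horner_linprod1.
set u := coef_sum _ _; set P := \prod_(_ <- _) _.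
have -> : u + P + c * u = (1 + c) * u + P by ring.
have IH' : `|u| <= (size cs)%:R * `|P| by apply: IH => x xs; apply: cs1; rewrite inE xs orbT.
rewrite (le_trans (ler_normD _ _)) // !normrM /= -natr1 mulrDl mul1r lerD //.
  by rewrite mulrCA ler_wpM2l.
by rewrite ler_peMl.
Qed.

Lemma sub_natSS i : 1 - i.+2%:R = - i.+1%:R :> R.
Proof. by rewrite -nat1r opprD addrA subrr add0r. Qed.

Section Hook.
Variables (n k : nat).
Hypothesis kn : (0 < k < n)%N.

Let cs : seq R := [seq - j.+2%:R | j <- iota 0 k.-1] ++ [seq i%:R | i <- iota 0 (n - k)].

Lemma hook_linprod : hook R n k = ('X - 1) * linprod cs.
Proof.
rewrite /hook /linprod big_cat !big_map /=.
case: k kn => // k' _; rewrite big_ord_recl /= -mulrA; congr (_ * (_ * _)).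
  have -> : iota 0 k' = index_iota 0 k' by rewrite /index_iota subn0.
  rewrite big_mkord.
  by apply: eq_bigr => i _; rewrite polyCN polyC_natr.
have -> : iota 0 (n - k'.+1) = index_iota 0 (n - k'.+1) by rewrite /index_iota subn0.
rewrite big_mkord.
by apply: eq_bigr => i _; rewrite polyC_natr.
Qed.

Lemma linprod_norm : \prod_(c <- cs) (1 + `|c|) <= ((k.+1)`! * (n - k)`!)%:R.
Proof.
rewrite big_cat !big_map natrM /=; apply: ler_pM => //.
- by apply: prodr_ge0 => i _; rewrite addr_ge0.
- by apply: prodr_ge0 => i _; rewrite addr_ge0.
- case: k kn => // k' _ /=; elim: k' => [|j IH]; first by rewrite big_nil ler1n.
  rewrite -[j.+1]addn1 iotaD big_cat /= big_seq1 add0n factS natrM mulrC.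
  apply: ler_pM; rewrite ?addr_ge0 //; first by apply: prodr_ge0 => i _; rewrite addr_ge0.
  - by rewrite normrN normr_nat addn1 nat1r.
  - by rewrite addn1.
elim: (n - k)%N => [|j IH]; first by rewrite big_nil.
rewrite -[j.+1]addn1 iotaD big_cat /= big_seq1 add0n addn1 factS natrM mulrC.
apply: ler_pM; rewrite ?addr_ge0 //; first by apply: prodr_ge0 => i _; rewrite addr_ge0.
by rewrite normr_nat nat1r.
Qed.

Lemma linprod_at1 : `|(linprod cs).[1]| = ((k.-1)`! * (n - k)`!)%:R.
Proof.
rewrite horner_linprod1 big_cat !big_map natrM normrM /=; congr (_ * _).
  elim: k.-1 => [|j IH]; first by rewrite big_nil normr1.
  rewrite -[in LHS](addn1 j) iotaD big_cat /= big_seq1 add0n normrM IH factS natrM mulrC.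
  by rewrite sub_natSS normrN normr_nat.
elim: (n - k)%N => [|j IH]; first by rewrite big_nil normr1.
rewrite -[in LHS](addn1 j) iotaD big_cat /= big_seq1 add0n normrM IH factS natrM mulrC.
by rewrite nat1r normr_nat.
Qed.

Lemma linprod_far c : c \in cs -> 1 <= `|1 + c|.
Proof.
rewrite mem_cat => /orP[] /mapP[i _ ->].
  by rewrite sub_natSS normrN normr_nat ler1n.
by rewrite nat1r normr_nat ler1n.
Qed.

Lemma size_linprod_cs : (size cs <= n)%N.
Proof. by rewrite size_cat !size_map !size_iota; move: kn; lia. Qed.

(** Multiplication by X - 1 is dual to taking differences. *)
Lemma coef_sum_hook f : coef_sum f (hook R n k) =
  coef_sum (fun i => f i.+1 - f i) (linprod cs).
Proof.
rewrite hook_linprod (_ : 'X - 1 = 'X + (-1)%:P); last by rewrite polyCN polyC1.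
rewrite coef_sum_XD -coef_sum_comb.
by apply: eq_coef_sum => i; rewrite mulN1r.
Qed.

Lemma coef_sum_hook_lip f M : (forall i, `|f i.+1 - f i| <= M) ->
  `|coef_sum f (hook R n k)| <= M * ((k.+1)`! * (n - k)`!)%:R.
Proof.
move=> fM; rewrite coef_sum_hook (le_trans (coef_sum_linprod_le _ fM)) //.
by rewrite ler_wpM2l ?linprod_norm // (le_trans _ (fM 0%N)).
Qed.

Lemma coef_sum_hook_id :
  `|coef_sum (fun i => i%:R) (hook R n k)| <= ((k.-1)`! * (n - k)`!)%:R.
Proof.
rewrite coef_sum_hook (@eq_coef_sum _ (fun=> 1)) => [|i]; last by rewrite -natr1 addrC addKr.
by rewrite coef_sum_const mulr1 linprod_at1.
Qed.

Lemma coef_sum_hook_sq :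
  `|coef_sum (fun i => i%:R ^+ 2) (hook R n k)| <= (n.*2.+1)%:R * ((k.-1)`! * (n - k)`!)%:R.
Proof.
rewrite coef_sum_hook (@eq_coef_sum _ (fun i => 1 + 2%:R * i%:R)) => [|i]; last first.
  by rewrite -natr1; ring.
rewrite coef_sum_comb coef_sum_const mulr1 (le_trans (ler_normD _ _)) //.
have -> : n.*2.+1%:R = 1 + 2%:R * n%:R :> R by rewrite -natrM mul2n nat1r.
rewrite -linprod_at1 [X in _ <= X]mulrDl mul1r lerD // normrM normr_nat -mulrA.
rewrite ler_wpM2l // (le_trans (coef_sum_id_linprod_le linprod_far)) //.
by rewrite ler_wpM2r // ler_nat size_linprod_cs.
Qed.

End Hook.

End CoefficientFunctional.

(** * Two sums of inverse binomial coefficients *)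
Section FactorialSums.
Local Open Scope nat_scope.

(** Products of two factorials of given sum increase with the difference. *)
Lemma fact_mul_le c a e : c <= a -> a`! * (c + e)`! <= (a + e)`! * c`!.
Proof.
move=> ca; elim: e => [|e IH]; first by rewrite !addn0.
rewrite !addnS !factS mulnCA -mulnA; apply: leq_mul IH.
by rewrite ltnS leq_add2r.
Qed.

(** The term k = n.-1 is n!, and each of the others is at most 2 (n-1)!. *)
Lemma sum_fact_lip n : 0 < n ->
  \sum_(k < n | 0 < k) (k.+1)`! * (n - k)`! <= 3 * n`!.
Proof.
case: n => // n _; rewrite big_mkcond big_ord_recr /= subSnn muln1.
rewrite (_ : 3 * _ = 2 * n.+1`! + n.+1`!); last by lia.
apply: leq_add; last by case: ifP => //; rewrite fact_gt0; lia.
rewrite -big_mkcond /=; apply: (@leq_trans (\sum_(k < n | 0 < k) 2 * n`!)).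
  apply: leq_sum => k k0; have kn := ltn_ord k.
  have -> : (n.+1 - k) = 2 + (n - k.+1) by lia.
  rewrite (leq_trans (@fact_mul_le 2 k.+1 (n - k.+1) _)) //.
  by rewrite subnKC // mulnC.
rewrite sum_nat_const mulnCA leq_mul2l /= factS leq_mul2r; apply/orP; right.
by rewrite (leq_trans (max_card _)) // card_ord.
Qed.

(** The term k = 1 is (n-1)!, and each of the others is at most (n-2)!. *)
Lemma sum_fact_moment n : 0 < n ->
  \sum_(k < n | 0 < k) (k.-1)`! * (n - k)`! <= 2 * (n.-1)`!.
Proof.
case: n => // n _; rewrite big_mkcond big_ord_recl /= add0n.
case: n => [|n]; first by rewrite big_ord0.
rewrite big_ord_recl /= /bump /= !mul1n subSS subn0 mulSn mul1n leq_add2l.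
apply: (@leq_trans (\sum_(k < n) n`!)).
  apply: leq_sum => k _; have kn := ltn_ord k.
  rewrite /bump /=.
  have -> : n.+2 - (1 + (1 + k)) = 1 + (n - k.+1) by lia.
  have -> : 1 + k = k.+1 by [].
  rewrite (leq_trans (@fact_mul_le 1 k.+1 (n - k.+1) _)) // muln1.
  by rewrite subnKC.
by rewrite sum_nat_const card_ord factS leq_mul2r leqnSn orbT.
Qed.
End FactorialSums.

(** * The number of cycles of a uniform permutation *)
Section CyclesOfUniform.
Variable R : realFieldType.
Implicit Types (f : nat -> R).

(** [hook n 0] is the rising factorial, which counts the permutations of n points
    by their number of cycles. *)
Definition perm_mean n f : R := coef_sum f (hook R n 0) / n`!%:R.

Lemma fact_neq0 n : n`!%:R != 0 :> R.
Proof. by rewrite pnatr_eq0 -lt0n fact_gt0. Qed.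

Lemma perm_meanS n f :
  n.+1%:R * perm_mean n.+1 f = perm_mean n (fun i => f i.+1) + n%:R * perm_mean n f.
Proof.
rewrite /perm_mean /hook !big_ord0 !mul1r !subn0 big_ord_recr /= mulrC -polyC_natr.
rewrite [_ * ('X + _)]mulrC coef_sum_XD factS natrM.
have n1 : n.+1%:R != 0 :> R by rewrite pnatr_eq0.
have := fact_neq0 n; move: n`!%:R => x x0; field.
by rewrite x0 nat1r n1.
Qed.

Lemma perm_mean0 f : perm_mean 0 f = f 0%N.
Proof. by rewrite /perm_mean /hook !big_ord0 mulr1 coef_sum1 fact0 divr1. Qed.

Lemma perm_mean_comb n f g c :
  perm_mean n (fun i => f i + c * g i) = perm_mean n f + c * perm_mean n g.
Proof. by rewrite /perm_mean coef_sum_comb mulrDl mulrA. Qed.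

Lemma eq_perm_mean n f g : f =1 g -> perm_mean n f = perm_mean n g.
Proof. by move=> fg; rewrite /perm_mean (eq_coef_sum _ fg). Qed.

Lemma perm_mean_const n c : perm_mean n (fun=> c) = c.
Proof.
elim: n => [|n IH]; first by rewrite perm_mean0.
apply: (mulfI (_ : n.+1%:R != 0)); first by rewrite pnatr_eq0.
by rewrite perm_meanS IH -nat1r mulrDl mul1r.
Qed.

Lemma perm_mean_le n f g : (forall i, f i <= g i) -> perm_mean n f <= perm_mean n g.
Proof.
elim: n f g => [|n IH] f g fg; first by rewrite !perm_mean0.
have n0 : 0 < n.+1%:R :> R by rewrite ltr0n.
by rewrite -(ler_pM2l n0) !perm_meanS lerD ?ler_wpM2l ?IH.
Qed.

Lemma perm_mean_norm n f M : (forall i, `|f i| <= M) -> `|perm_mean n f| <= M.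
Proof.
move=> fM; rewrite ler_norml; apply/andP; split.
  rewrite -[X in X <= _](perm_mean_const n); apply: perm_mean_le => i.
  by have := fM i; rewrite ler_norml => /andP[].
rewrite -[X in _ <= X](perm_mean_const n); apply: perm_mean_le => i.
exact: le_trans (ler_norm _) (fM i).
Qed.

Definition harm n : R := \sum_(j < n) j.+1%:R^-1.
Definition harm2 n : R := \sum_(j < n) j.+1%:R^-1 ^+ 2.

Lemma perm_mean_id n : perm_mean n (fun i => i%:R) = harm n.
Proof.
elim: n => [|n IH]; first by rewrite perm_mean0 /harm big_ord0.
have n0 : n.+1%:R != 0 :> R by rewrite pnatr_eq0.
apply: (mulfI n0); rewrite perm_meanS (@eq_perm_mean _ _ (fun i => i%:R + 1 * 1)).
  rewrite (perm_mean_comb _ _ (fun=> 1)) perm_mean_const IH /harm big_ord_recr /=.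
  by rewrite mulrDr divff // -nat1r; ring.
by move=> i; rewrite mulr1 natr1.
Qed.

Lemma perm_mean_sq n : perm_mean n (fun i => i%:R ^+ 2) = harm n ^+ 2 + harm n - harm2 n.
Proof.
elim: n => [|n IH].
  by rewrite perm_mean0 /harm /harm2 !big_ord0 expr0n /= !addr0 subr0.
have n0 : n.+1%:R != 0 :> R by rewrite pnatr_eq0.
apply: (mulfI n0); rewrite perm_meanS.
rewrite (@eq_perm_mean _ (fun i => i.+1%:R ^+ 2) (fun i => (i%:R ^+ 2 + 2%:R * i%:R) + 1 * 1)).
  rewrite (perm_mean_comb _ _ (fun=> 1)) (perm_mean_comb _ (fun i => i%:R ^+ 2)).
  rewrite perm_mean_const perm_mean_id IH /harm /harm2 !big_ord_recr /=.
  move: (\sum_(_ < n) _) (\sum_(_ < n) _) => h g.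
  have -> : n.+1%:R = 1 + n%:R :> R by rewrite nat1r.
  by field; rewrite nat1r.
by move=> i; rewrite -nat1r; ring.
Qed.

(** The number of cycles is a sum of independent Bernoulli variables, of
    parameters p = 1/1, ..., 1/n.  Conditioning the product with f on one of them
    being 1, instead of omitting it, costs p times a difference of f; this
    happens with probability p. *)
Lemma perm_mean_stein n f M : (forall i, `|f i.+1 - f i| <= M) ->
  `|perm_mean n (fun i => i%:R * f i) - harm n * perm_mean n (fun i => f i.+1)| <= harm2 n * M.
Proof.
elim: n f => [|n IH] f fM.
  by rewrite !perm_mean0 /harm /harm2 !big_ord0 !mul0r subrr normr0.
have n0 : n.+1%:R != 0 :> R by rewrite pnatr_eq0.
set p := (n.+1%:R)^-1 : R.
have rec g : perm_mean n.+1 g = (1 - p) * perm_mean n g + p * perm_mean n (fun i => g i.+1).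
  apply: (mulfI n0); rewrite perm_meanS /p -nat1r; field; by rewrite nat1r.
have E1 := rec (fun i => i%:R * f i); have E2 := rec (fun i => f i.+1).
have E3 : perm_mean n (fun i => i.+1%:R * f i.+1) =
    perm_mean n (fun i => i%:R * f i.+1) + perm_mean n (fun i => f i.+1).
  rewrite -[X in _ + X]mul1r -perm_mean_comb; apply: eq_perm_mean => i.
  by rewrite -nat1r; ring.
have H1 := IH f fM; have H2 := IH (fun i => f i.+1) (fun i => fM i.+1).
have H3 : `|perm_mean n (fun i => f i.+1) - perm_mean n (fun i => f i.+2)| <= M.
  rewrite -mulN1r -perm_mean_comb; apply: perm_mean_norm => i.
  by rewrite mulN1r distrC fM.
rewrite /harm /harm2 !big_ord_recr /= -/(harm n) -/(harm2 n) -/p.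
move: E1 E2; rewrite E3 => -> ->.
move: H1 H2 H3; set a := perm_mean n _; set b := perm_mean n (fun i => f i.+1).
set c := perm_mean n (fun i => _ * f i.+1); set d := perm_mean n (fun i => f i.+2) => H1 H2 H3.
have -> : (1 - p) * a + p * (c + b) - (harm n + p) * ((1 - p) * b + p * d) =
   (1 - p) * (a - harm n * b) + p * (c - harm n * d) + p ^+ 2 * (b - d) by ring.
have p0 : 0 <= p by rewrite invr_ge0.
have p1 : 0 <= 1 - p by rewrite subr_ge0 invf_le1 ?ler1n ?ltr0n.
have -> : (harm2 n + p ^+ 2) * M = (1 - p) * (harm2 n * M) + p * (harm2 n * M) + p ^+ 2 * M by ring.
rewrite (le_trans (ler_normD _ _)) // lerD //; last first.
  by rewrite normrM ger0_norm ?exprn_ge0 // ler_wpM2l ?exprn_ge0.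
by rewrite (le_trans (ler_normD _ _)) // lerD // normrM ger0_norm // ler_wpM2l.
Qed.
End CyclesOfUniform.

(** * Comparison of full cycles with uniform permutations *)
Section FullCycleMean.
Import mathcomp.boot.fintype mathcomp.boot.finset.
Local Open Scope ring_scope.
Variable R : realFieldType.
Variables (D : finType) (H : {set D}) (t : {perm D}).
Implicit Types (f : nat -> R).

Let n := #|H|.
Let d := (#|D| - n)%N.

Hypotheses (tH : perm_on H t) (H0 : (0 < #|H|)%N) (t2 : (cyc_in H t <= 2)%N).

Definition full_cycles : {set {perm D}} := [set s | full_cycle H s].

(** The points outside H are fixed by t * s; subtracting their number leaves the
    number of cycles inside H. *)
Definition cycle_mean f : R :=
  (\sum_(s in full_cycles) f (ncyc (t * s)%g - d)%N) / #|full_cycles|%:R.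

Lemma full_cycle_expansion : exists2 e : nat -> R,
  e 0%N = 1 /\ (forall k, `|e k| <= 4%:R) & forall f,
  n%:R * (\sum_(s in full_cycles) f (ncyc (t * s)%g - d)%N) =
  \sum_(k < n) e k * coef_sum f (hook R n k).
Proof.
have [e [e0 e4 eE]] := sum_full_cycle_hook R tH H0.
exists e => [|f]; first by split=> // k; rewrite (le_trans (e4 k)) // ler_nat (@leq_pexp2l 2 _ 2).
have nD : (n <= #|D|)%N by exact: max_card.
have Xn : 'X^n != 0 :> {poly R} by rewrite expf_neq0 // polyX_eq0.
have {}eE : n%:R%:P * (\sum_(s | full_cycle H s) 'X^(ncyc (t * s)%g)) =
    'X^d * \sum_(k < n) (e k)%:P * hook R n k.
  apply: (mulfI Xn); rewrite [RHS]mulrA -exprD subnKC // -eE polyC_natr.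
  by rewrite mulrA [_%:R * _]mulrC.
have := congr1 (coef_sum (fun i => f (i - d)%N)) eE.
rewrite coef_sumC linear_sum /= (eq_bigr (fun s : {perm D} => f (ncyc (t * s)%g - d)%N)) => [|s _]; last first.
  exact: coef_sumXn.
rewrite (eq_bigl (mem full_cycles)) => [->|s]; last by rewrite !inE.
rewrite coef_sumXnM (@eq_coef_sum _ _ f) => [|i]; last by rewrite addnK.
by rewrite linear_sum; apply: eq_bigr => k _; exact: coef_sumC.
Qed.


Lemma card_full_cycles : (n * #|full_cycles|)%N = n`!.
Proof.
apply/eqP; rewrite -(eqr_nat R); have [e [e0 _] /(_ (fun=> 1))] := full_cycle_expansion.
rewrite sumr_const natrM => ->; have n0 : (0 < n)%N := H0.
(* At 1, the hooks with k > 0 vanish. *)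
rewrite (bigD1 (Ordinal n0)) //= e0 mul1r big1 ?addr0 => [|k]; last first.
  by rewrite -val_eqE /= -lt0n => k0; rewrite coef_sum_const (@hook_root _ _ 0) // mul0r mulr0.
have := perm_mean_const n (1 : R); rewrite /perm_mean => /(canRL (divfK (fact_neq0 _ _))) ->.
by rewrite mul1r.
Qed.

Lemma full_cycles_gt0 : (0 < #|full_cycles|)%N.
Proof. by have := fact_gt0 n; rewrite -card_full_cycles muln_gt0 => /andP[]. Qed.

Lemma eq_cycle_mean f g : f =1 g -> cycle_mean f = cycle_mean g.
Proof. by move=> fg; rewrite /cycle_mean; congr (_ / _); apply: eq_bigr => s _; rewrite fg. Qed.

Lemma cycle_mean_comb f g c :
  cycle_mean (fun i => f i + c * g i) = cycle_mean f + c * cycle_mean g.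
Proof. by rewrite /cycle_mean big_split -mulr_sumr mulrDl mulrA. Qed.

Lemma cycle_mean_const c : cycle_mean (fun=> c) = c.
Proof.
by rewrite /cycle_mean sumr_const -[c *+ _]mulr_natr mulfK // pnatr_eq0 -lt0n full_cycles_gt0.
Qed.

(** Only the hooks with k > 0 distinguish the two means, and their coefficients
    are at most 4 in absolute value. *)
Lemma cycle_mean_perm_mean f (B : nat -> R) :
  (forall k, (0 < k < n)%N -> `|coef_sum f (hook R n k)| <= B k) ->
  `|cycle_mean f - perm_mean n f| <= 4%:R * (\sum_(k < n | (0 < k)%N) B k) / n`!%:R.
Proof.
move=> fB; have [e [e0 e4] /(_ f) eE] := full_cycle_expansion; have n0 : (0 < n)%N := H0.
have f0 : (0 : R) < n`!%:R by rewrite ltr0n fact_gt0.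
have -> : cycle_mean f - perm_mean n f =
    (\sum_(k < n | (0 < k)%N) e k * coef_sum f (hook R n k)) / n`!%:R.
  have -> : cycle_mean f = (\sum_(k < n) e k * coef_sum f (hook R n k)) / n`!%:R.
    rewrite -eE -card_full_cycles natrM /cycle_mean.
    have : n%:R != 0 :> R by rewrite pnatr_eq0 -lt0n.
    have : #|full_cycles|%:R != 0 :> R by rewrite pnatr_eq0 -lt0n full_cycles_gt0.
    move: (\sum_(_ in _) _) (#|_|%:R) (n%:R) => x y z y0 z0.
    by field; rewrite y0 z0.
  rewrite /perm_mean -mulrBl; congr (_ / _).
  rewrite (bigD1 (Ordinal n0)) //= e0 mul1r addrAC subrr add0r.
  by apply: eq_bigl => k; rewrite -val_eqE /= -lt0n.
rewrite normrM normfV [`|n`!%:R|]gtr0_norm // ler_pM2r ?invr_gt0 //.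
rewrite (le_trans (ler_norm_sum _ _ _)) // mulr_sumr; apply: ler_sum => k k0.
by rewrite normrM ler_pM // fB // k0 ltn_ord.
Qed.

Lemma cycle_mean_lip f M : (forall i, `|f i.+1 - f i| <= M) ->
  `|cycle_mean f - perm_mean n f| <= 12%:R * M.
Proof.
move=> fM; have M0 : 0 <= M by apply: le_trans (fM 0%N).
apply: le_trans (cycle_mean_perm_mean (fun k kn => coef_sum_hook_lip kn fM)) _.
rewrite -mulr_sumr -natr_sum ler_pdivrMr ?ltr0n ?fact_gt0 //.
rewrite [X in _ <= X](_ : _ = 4%:R * (M * (3 * n`!)%:R)); last by rewrite natrM; ring.
by rewrite ler_wpM2l // ler_wpM2l // ler_nat sum_fact_lip.
Qed.

Lemma cycle_mean_id : `|cycle_mean (fun i => i%:R) - harm R n| <= 8%:R / n%:R.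
Proof.
have n0 : (0 < n)%N := H0; rewrite -perm_mean_id.
apply: le_trans (cycle_mean_perm_mean (fun k kn => coef_sum_hook_id R kn)) _.
rewrite -natr_sum ler_pdivrMr ?ltr0n ?fact_gt0 // -[X in X`!](prednK n0) factS natrM prednK //.
rewrite mulrA divfK ?pnatr_eq0 -?lt0n //.
by rewrite -!natrM ler_nat -[8%N]/(4 * 2)%N -mulnA leq_mul2l sum_fact_moment.
Qed.

Lemma cycle_mean_sq :
  `|cycle_mean (fun i => i%:R ^+ 2) - (harm R n ^+ 2 + harm R n - harm2 R n)| <= 24%:R.
Proof.
have n0 : (0 < n)%N := H0; rewrite -perm_mean_sq.
apply: le_trans (cycle_mean_perm_mean (fun k kn => coef_sum_hook_sq R kn)) _.
rewrite -mulr_sumr -natr_sum ler_pdivrMr ?ltr0n ?fact_gt0 // -[X in X`!](prednK n0) factS prednK //.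
rewrite -!natrM ler_nat; apply: (@leq_trans (4 * (n.*2.+1 * (2 * n.-1`!)))).
  by rewrite leq_mul2l leq_mul2l sum_fact_moment // orbT.
rewrite !mulnA leq_mul2r; apply/orP; right; lia.
Qed.

End FullCycleMean.

(** * Shortcutting a permutation to a subset *)
Section Shortcut.
Import mathcomp.boot.fintype mathcomp.boot.finset.
Variable D : finType.
Implicit Types (s t r : {perm D}) (H : {set D}).

(** Points d outside H are removed from the cycles of s one after the other, by
    composing with the transposition of d and its preimage.  Each step adds one
    cycle, the fixed point d, and commutes with the later composition with r,
    as r fixes d. *)
Lemma shortcut H s : exists t c, [/\ perm_on H t, (c <= #|~: H|)%N &
  forall r, perm_on H r -> (ncyc (s * r)%g + c)%N = ncyc (t * r)%g].
Proof.
pose moved s := [set x in ~: H | s x != x].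
suff [t [c [tH cm E]]] : exists t c, [/\ perm_on H t, (c <= #|moved s|)%N &
  forall r, perm_on H r -> (ncyc (s * r)%g + c)%N = ncyc (t * r)%g].
  exists t, c; split => //; rewrite (leq_trans cm) // subset_leq_card //.
  by apply/subsetP => x; rewrite inE => /andP[].
have [m] := ubnP #|moved s|; elim: m s => // m IH s /ltnSE sm.
have [m0|[d]] := set_0Vmem (moved s).
  exists s, 0%N; split => // [|r _]; last by rewrite addn0.
  apply/subsetP => x; rewrite inE => sx; apply: contraTT isT => xH.
  by have : x \in moved s; [rewrite !inE xH|rewrite m0 inE].
rewrite !inE => /andP[dH sd]; pose x := (s^-1)%g d.
have sx : s x = d by rewrite permKV.
have dx : d != x by apply: contraNneq sd => E; rewrite {1}E sx.
pose s' := (tperm d x * s)%g.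
have moved' : moved s' \subset moved s :\ d.
  apply/subsetP => y; rewrite !inE => /andP[yH]; rewrite permM yH /=.
  case: tpermP => [->|->|/eqP yd /eqP yx ->]; first by rewrite sx eqxx.
    by move=> _; rewrite sx dx eq_sym dx.
  by rewrite yd.
have dm : d \in moved s by rewrite !inE dH.
have lt_m : (#|moved s'| < #|moved s|)%N.
  by rewrite (cardsD1 d (moved s)) dm ltnS subset_leq_card.
have [t [c [tH cm E]]] := IH s' (leq_trans lt_m sm).
exists t, c.+1; split => // [|r rH]; first exact: leq_ltn_trans lt_m.
rewrite -E // addnS -addSn; congr (_ + _)%N.
have := porbits_mul_tperm (s * r)%g d x; rewrite /= dx mulgA -/s'.
have -> : d \in porbit (s * r)%g x.
  by have := mem_porbit (s * r)%g 1 x; rewrite expg1 permM sx (out_perm rH).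
by rewrite /ncyc addn0 addn1 => ->.
Qed.

Lemma ncyc_perm_on H t : perm_on H t -> ncyc t = (cyc_in H t + #|~: H|)%N.
Proof. by move=> tH; rewrite -{1}(restr_perm_id tH) ncyc_restr // perm_on_stab. Qed.

Lemma cyc_in_gt0 H t : perm_on H t -> (0 < #|H|)%N -> (0 < cyc_in H t)%N.
Proof.
move=> tH /card_gt0P[h hH]; apply/card_gt0P; exists (porbit t h).
by rewrite inE imset_f ?porbit_stab ?perm_on_stab.
Qed.

Lemma cyc_in_le H t : (cyc_in H t <= #|H|)%N.
Proof.
apply: leq_trans (leq_imset_card (porbit t) H); apply/subset_leq_card/subsetP => C.
rewrite inE => /andP[/imsetP[x _ ->] xH]; apply: imset_f.
exact: (subsetP xH) (porbit_id t x).
Qed.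

Lemma eq_in_porbit (S : {set D}) s t x : (forall y, y \in S -> s y = t y) -> t \in ('N(S | 'P))%g ->
  x \in S -> porbit s x = porbit t x.
Proof.
move=> st tS xS; apply/setP => y.
suff E i : (s ^+ i)%g x = (t ^+ i)%g x.
  by apply/porbitP/porbitP => -[i ->]; exists i; rewrite E.
rewrite !permX; elim: i => //= i ->; apply: st.
by rewrite -permX; have /stabP -> : (t ^+ i)%g \in ('N(S | 'P))%g by rewrite groupX.
Qed.

Lemma card_imset_same_kernel (T1 T2 : finType) (f : D -> T1) (g : D -> T2) :
  (forall x y, (f x == f y) = (g x == g y)) -> #|f @: D| = #|g @: D|.
Proof.
move=> fg; suff W (T1' T2' : finType) (f' : D -> T1') (g' : D -> T2') :
    (forall x y, (f' x == f' y) = (g' x == g' y)) -> (#|f' @: D| <= #|g' @: D|)%N.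
  by apply/eqP; rewrite eqn_leq !W.
move=> fg'; pose h u := omap g' [pick x | f' x == u].
have hE x : h (f' x) = Some (g' x).
  rewrite /h; case: pickP => [y|/(_ x)]; last by rewrite eqxx.
  by rewrite fg' => /eqP /= ->.
rewrite -(card_in_imset (f := h)); last first.
  move=> _ _ /imsetP[x _ ->] /imsetP[y _ ->]; rewrite !hE => -[/eqP].
  by rewrite -fg' => /eqP.
rewrite -(card_imset (g' @: D) (@Some_inj _)); apply/subset_leq_card/subsetP => _ /imsetP[_ /imsetP[x _ ->] ->].
by rewrite hE !imset_f.
Qed.

Lemma sum_card_porbits s : (\sum_(C in porbits s) #|C|)%N = #|D|.
Proof.
rewrite -sum1_card (partition_big (porbit s) (mem (porbits s))) /=; last by move=> x _; exact: imset_f.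
apply: eq_bigr => _ /imsetP[x _ ->]; rewrite -sum1_card; apply: eq_bigl => y.
by rewrite eq_porbit_mem.
Qed.

Lemma porbit3 s x : #|porbit s x| = 3%N ->
  [/\ x != s x, x != s (s x), s x != s (s x), s (s (s x)) = x & porbit s x = [set x; s x; s (s x)]].
Proof.
move=> x3; have := uniq_traject_porbit s x; have := iter_porbit s x.
rewrite x3 /= !inE negb_or => -> /andP[/andP[-> ->] /andP[-> _]]; split => //.
by apply/setP => y; rewrite porbit_traject x3 /= !inE -orbA.
Qed.
End Shortcut.

(** * Rotation systems of a graph *)
Section RotationSystems.
Import mathcomp.boot.fintype mathcomp.boot.finset.
Local Open Scope set_scope.
Local Open Scope nat_scope.
Variable G : sgraph.
Implicit Types (d : dart G) (v : vert G) (rho : {perm dart G}).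

Definition out_darts v : {set dart G} := [set d | dart_tail d == v].

Lemma rotation_systemsP rho :
  reflect (forall d, porbit rho d = out_darts (dart_tail d)) (rho \in rotation_systems G).
Proof.
rewrite inE; apply: (iffP forallP) => rP d; first by rewrite (eqP (rP d)).
by rewrite rP.
Qed.

(** At each vertex, take the cyclic order given by the enumeration of its darts. *)
Lemma rotation_systems_neq0 : rotation_systems G != set0.
Proof.
pose p d := enum (out_darts (dart_tail d)).
have dp d : d \in p d by rewrite mem_enum inE.
have pu d : uniq (p d) by exact: enum_uniq.
pose f d := next (p d) d.
have fp d : f d \in p d by rewrite mem_next.
have pf d : p (f d) = p d.
  by have := fp d; rewrite mem_enum inE /p => /eqP ->.
have f_inj : injective f.
  move=> x y E; have pE : p x = p y by rewrite -(pf x) E pf.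
  by rewrite -(prev_next (pu x) x) -/(f x) E pE prev_next.
apply/set0Pn; exists (perm f_inj); apply/rotation_systemsP => d; apply/setP => x.
have f_cyc : fcycle (perm f_inj) (p d).
  have all_p : all (mem (p d)) (p d) by apply/allP.
  have E : {in mem (p d) &, frel (next (p d)) =2 frel (perm f_inj)}.
    move=> u w; rewrite [_ \in _]mem_enum inE => /eqP E _ /=.
    by rewrite permE /f /p E.
  by rewrite -(eq_in_cycle E all_p) cycle_next.
have := fconnect_cycle f_cyc (dp d) x; rewrite mem_enum => <-.
apply/porbitP/idP => [[i ->]|xd]; first by rewrite permX fconnect_iter.
by exists (findex (perm f_inj) d x); rewrite permX iter_findex.
Qed.

Lemma dart_rev_permE d : dart_rev_perm G d = dart_rev d.
Proof. by rewrite permE. Qed.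

Lemma dart_rev_neq d : dart_rev d != d.
Proof.
case: d => [[a b] ab]; apply/eqP => /(congr1 val) /= [E _].
by move: (ab); rewrite /= E adj_irr.
Qed.

Lemma porbit_dart_rev d : porbit (dart_rev_perm G) d = [set d; dart_rev d].
Proof.
apply/setP => x; rewrite !inE; apply/porbitP/orP => [[i ->]|[] /eqP ->].
- rewrite permX; elim: i => [|i] /=; first by left.
  by case=> /eqP -> ; rewrite dart_rev_permE ?dart_revK; [right|left].
- by exists 0; rewrite expg0 perm1.
- by exists 1; rewrite expg1 dart_rev_permE.
Qed.

Lemma card_dart_rev_orbits : (ncyc (dart_rev_perm G)).*2 = #|dart G|.
Proof.
rewrite -(sum_card_porbits (dart_rev_perm G)) -muln2 -sum_nat_const.
apply: eq_bigr => _ /imsetP[d _ ->].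
by rewrite porbit_dart_rev cards2 eq_sym dart_rev_neq.
Qed.

(** Edges and orbits of the reversal are both quotients of the set of darts, by
    the same equivalence. *)
Lemma card_edges : #|edges G| = ncyc (dart_rev_perm G).
Proof.
pose eps d : {set vert G} := [set (val d).1; (val d).2].
have -> : edges G = eps @: dart G.
  apply/setP => e; apply/imsetP/imsetP => [[p pP ->]|[d _ ->]].
    have pA : adj p.1 p.2 by move: pP; rewrite inE.
    by exists (Sub p pA : dart G).
  by exists (val d) => //; rewrite inE; exact: (valP d).
apply: card_imset_same_kernel => x y; rewrite eq_porbit_mem porbit_dart_rev !inE.
rewrite /eps -[x == y]val_eqE -[x == dart_rev y]val_eqE /=; case: x y => [[a b] ab] [[a' b'] ab'] /=; rewrite !xpair_eqE.
have nab : a != b by apply: contraTneq ab => ->; rewrite /= adj_irr.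
apply/eqP/orP => [/setP E|[] /andP[/eqP -> /eqP ->] //]; last by rewrite setUC.
have := E a; have := E b; rewrite !inE !eqxx orbT /=.
move/esym/orP => [/eqP bE|/eqP bE] /esym/orP [/eqP aE|/eqP aE].
- by rewrite aE bE eqxx in nab.
- by right; rewrite aE bE !eqxx.
- by left; rewrite aE bE !eqxx.
- by rewrite aE bE eqxx in nab.
Qed.

Lemma ncyc_rotation rho : (forall v, exists w, adj v w) -> rho \in rotation_systems G ->
  ncyc rho = #|vert G|.
Proof.
move=> iso /rotation_systemsP rP; rewrite /ncyc.
have -> : #|vert G| = #|@dart_tail G @: dart G|.
  rewrite -cardsT; congr #|pred_of_set _|; apply/setP => v; rewrite inE; apply/esym/imsetP.
  by have [w vw] := iso v; exists (Sub (v, w) vw : dart G).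
apply: card_imset_same_kernel => x y.
by rewrite eq_porbit_mem rP inE.
Qed.

(** Compare the signs in face_perm rho = dart_rev_perm G * rho. *)
Lemma euler_parity rho : (forall v, exists w, adj v w) -> rho \in rotation_systems G ->
  odd (#|vert G| + #|edges G| + nb_faces rho) = false.
Proof.
move=> iso rP; rewrite -(ncyc_rotation iso rP) card_edges /nb_faces.
have : odd_perm (face_perm rho) = odd_perm (dart_rev_perm G) (+) odd_perm rho by rewrite odd_permM.
rewrite /odd_perm -card_dart_rev_orbits odd_double /= -!/(ncyc _) !oddD.
by move=> ->; case: (odd (ncyc rho)); case: (odd _).
Qed.

End RotationSystems.

(** * The darts of a wheel *)
Section WheelDarts.
Import mathcomp.boot.fintype mathcomp.boot.finset.
Local Open Scope set_scope.
Local Open Scope nat_scope.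
Variable n : nat.
Hypothesis n3 : 3 <= n.
Implicit Types (i j : 'I_n) (r : {perm dart (wheel n)}).

Lemma ordS_val i : val (ordS i) = if i.+1 == n then 0 else i.+1.
Proof.
rewrite /=; case: eqP => [->|ni]; first by rewrite modnn.
by rewrite modn_small //; have := ltn_ord i; lia.
Qed.

Lemma ordS_neq i : ordS i != i.
Proof. by rewrite -val_eqE ordS_val /=; case: ifP => /eqP ?; apply/eqP; lia. Qed.

Lemma ordSS_neq i : ordS (ordS i) != i.
Proof.
rewrite -val_eqE ordS_val ordS_val /=.
by case: (i.+1 =P n) => ?; case: ifP => /eqP ?; apply/eqP; lia.
Qed.

Lemma ordS_pred_neq i : ordS i != ord_pred i.
Proof. by rewrite -{1}[i]ord_predK ordSS_neq. Qed.

Lemma cycle_adjE i j : @cycle_adj n i j = (j == ordS i) || (j == ord_pred i).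
Proof.
have -> : @cycle_adj n i j = (i != j) && ((j == ordS i) || (i == ordS j)) by [].
rewrite -(can2_eq (@ordSK n) (@ord_predK n)) (eq_sym (ordS j)).
have [->|//] := eqVneq i j.
by rewrite eq_sym (negbTE (ordS_neq j)).
Qed.

Lemma adj_ordS i : adj (Some i : vert (wheel n)) (Some (ordS i)).
Proof. by rewrite /= cycle_adjE eqxx. Qed.

Lemma adj_ord_pred i : adj (Some i : vert (wheel n)) (Some (ord_pred i)).
Proof. by rewrite /= cycle_adjE eqxx orbT. Qed.

Definition spoke_in i : dart (wheel n) := @Sub _ _ (dart (wheel n)) (Some i, None) isT.
Definition spoke_out i : dart (wheel n) := @Sub _ _ (dart (wheel n)) (None, Some i) isT.
Definition rim_up i : dart (wheel n) := @Sub _ _ (dart (wheel n)) (Some i, Some (ordS i)) (adj_ordS i).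
Definition rim_down i : dart (wheel n) := @Sub _ _ (dart (wheel n)) (Some i, Some (ord_pred i)) (adj_ord_pred i).

Definition hub : {set dart (wheel n)} := out_darts (None : vert (wheel n)).

Variant dart_spec : dart (wheel n) -> Prop :=
  | SpokeIn i : dart_spec (spoke_in i)
  | SpokeOut i : dart_spec (spoke_out i)
  | RimUp i : dart_spec (rim_up i)
  | RimDown i : dart_spec (rim_down i).

Lemma dartP d : dart_spec d.
Proof.
case: d => [[[i|] [j|]] ij] //.
- have := ij; rewrite /= cycle_adjE => /orP[] /eqP E.
    suff -> : exist _ (Some i, Some j) ij = rim_up i by constructor.
    by apply: val_inj; rewrite /= E.
  suff -> : exist _ (Some i, Some j) ij = rim_down i by constructor.
  by apply: val_inj; rewrite /= E.
- suff -> : exist _ (Some i, None) ij = spoke_in i by constructor.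
  exact: val_inj.
suff -> : exist _ (None, Some j) ij = spoke_out j by constructor.
exact: val_inj.
Qed.

Lemma rev_spoke_in i : dart_rev (spoke_in i) = spoke_out i.
Proof. exact: val_inj. Qed.
Lemma rev_spoke_out i : dart_rev (spoke_out i) = spoke_in i.
Proof. exact: val_inj. Qed.
Lemma rev_rim_up i : dart_rev (rim_up i) = rim_down (ordS i).
Proof. by apply: val_inj; rewrite /= ordSK. Qed.
Lemma rev_rim_down i : dart_rev (rim_down i) = rim_up (ord_pred i).
Proof. by apply: val_inj; rewrite /= ord_predK. Qed.

Lemma out_darts_rim i : out_darts (Some i : vert (wheel n)) = [set spoke_in i; rim_up i; rim_down i].
Proof.
apply/setP => d; rewrite !inE; case: (dartP d) => j; rewrite -!val_eqE /= !xpair_eqE.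
- by rewrite !andbT !andbF !orbF.
- by [].
- rewrite andbF /=; case: eqP => //= -[->]; by rewrite eqxx.
- rewrite andbF /=; case: eqP => //= -[->]; by rewrite eqxx orbT.
Qed.

Lemma card_out_darts_rim i : #|out_darts (Some i : vert (wheel n))| = 3.
Proof.
rewrite out_darts_rim -setUA cardsU1 cards2 !inE -!val_eqE /= !xpair_eqE !andbF /=.
by rewrite eqxx /= (inj_eq Some_inj) ordS_pred_neq.
Qed.

Lemma in_hub d : (d \in hub) = (dart_tail d == None).
Proof. by rewrite inE. Qed.

Lemma spoke_out_hub i : spoke_out i \in hub. Proof. by rewrite in_hub. Qed.

Lemma card_hub : #|hub| = n.
Proof.
have -> : hub = spoke_out @: 'I_n.
  apply/setP => d; apply/idP/imsetP => [|[i _ ->]]; last exact: spoke_out_hub.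
  by rewrite in_hub; case: (dartP d) => // i _; exists i.
rewrite card_imset ?card_ord // => i j /(congr1 val) /= [].
by [].
Qed.

Lemma wheel_nonisolated (v : vert (wheel n)) : exists w, adj v w.
Proof.
case: v => [i|]; first by exists None.
by have n0 : 0 < n by [lia]; exists (Some (Ordinal n0)).
Qed.

(** The rotations at the rim vertices, extended by the identity to the darts out
    of the hub. *)
Definition rims : {set {perm dart (wheel n)}} :=
  [set r | perm_on (~: hub) r && [forall d in ~: hub, porbit r d == out_darts (dart_tail d)]].

(** A vertex of degree three has two rotations. *)
Lemma rim_cycle r i : r \in rims ->
  [/\ r (spoke_in i) = rim_up i, r (rim_up i) = rim_down i & r (rim_down i) = spoke_in i] \/
  [/\ r (spoke_in i) = rim_down i, r (rim_down i) = rim_up i & r (rim_up i) = spoke_in i].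
Proof.
rewrite inE => /andP[_ /forall_inP rP].
have ri : porbit r (spoke_in i) = [set spoke_in i; rim_up i; rim_down i].
  by rewrite -out_darts_rim; apply/eqP/rP; rewrite inE in_hub.
have rc : #|porbit r (spoke_in i)| = 3 by rewrite ri -out_darts_rim card_out_darts_rim.
have [d1 d2 d3 c3 E] := porbit3 rc.
have UE : rim_up i \in porbit r (spoke_in i) by rewrite ri !inE eqxx orbT.
have LE : rim_down i \in porbit r (spoke_in i) by rewrite ri !inE eqxx orbT.
move: UE LE; rewrite E !inE.
have UN : rim_up i != spoke_in i by rewrite -!val_eqE /= !xpair_eqE !andbF.
have LN : rim_down i != spoke_in i by rewrite -!val_eqE /= !xpair_eqE !andbF.
have UL : rim_up i != rim_down i.
  by rewrite -!val_eqE /= !xpair_eqE eqxx /= (inj_eq Some_inj) ordS_pred_neq.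
rewrite (negbTE UN) (negbTE LN) /= => /orP[]/eqP U /orP[]/eqP L.
- by rewrite U L eqxx in UL.
- by left; split; [rewrite -U|rewrite U -L|rewrite L].
- by right; split; [rewrite -L|rewrite L -U|rewrite U].
- by rewrite U L eqxx in UL.
Qed.

Lemma rim_fix r i : r \in rims -> r (spoke_out i) = spoke_out i.
Proof.
by rewrite inE => /andP[rH _]; apply: (out_perm rH); rewrite inE spoke_out_hub.
Qed.

(** Without rotation at the hub, the tracing runs along both ends of a spoke and
    comes back to the rim.  So all the darts rim_up lie in one orbit, all the
    darts rim_down in one orbit, and each spoke belongs to one of these. *)
Lemma ncyc_rim r : r \in rims -> ncyc (dart_rev_perm (wheel n) * r)%g <= 2.
Proof.
move=> rP; set s := (dart_rev_perm _ * r)%g.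
have sE d : s d = r (dart_rev d) by rewrite permM dart_rev_permE.
have step x y : s x = y -> porbit s y = porbit s x.
  by move=> <-; have := porbit_perm s 1 x; rewrite expg1.
have OI i : porbit s (spoke_out i) = porbit s (spoke_in i).
  by apply: step; rewrite sE rev_spoke_in rim_fix.
have rI i : porbit s (r (spoke_in i)) = porbit s (spoke_in i).
  by rewrite -OI; apply: step; rewrite sE rev_spoke_out.
have U i : porbit s (rim_up (ordS i)) = porbit s (rim_up i).
  have := step (rim_up i) _ erefl; rewrite sE rev_rim_up => <-.
  have := rI (ordS i); have [[-> _ ->]|[_ -> _]] := rim_cycle (ordS i) rP; last by [].
  by [].
have L i : porbit s (rim_down (ord_pred i)) = porbit s (rim_down i).
  have := step (rim_down i) _ erefl; rewrite sE rev_rim_down => <-.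
  by have := rI (ord_pred i); have [[_ -> _]|[-> _ ->]] := rim_cycle (ord_pred i) rP.
have n0 : 0 < n by lia.
pose i0 := Ordinal n0.
have ordS_lt k (kn : k < n) (k1 : k.+1 < n) : Ordinal k1 = ordS (Ordinal kn).
  by apply: val_inj; rewrite ordS_val /=; case: eqP; lia.
have U0 i : porbit s (rim_up i) = porbit s (rim_up i0).
  case: i; elim=> [|k IH] kn; first by congr (porbit _ (rim_up _)); exact: val_inj.
  by rewrite (ordS_lt k (ltnW kn)) U IH.
have L0 i : porbit s (rim_down i) = porbit s (rim_down i0).
  case: i; elim=> [|k IH] kn; first by congr (porbit _ (rim_down _)); exact: val_inj.
  by rewrite (ordS_lt k (ltnW kn)) -L ordSK IH.
have I0 i : porbit s (spoke_in i) \in [set porbit s (rim_up i0); porbit s (rim_down i0)].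
  by rewrite -rI; have [[-> _ _]|[-> _ _]] := rim_cycle i rP; rewrite ?U0 ?L0 !inE eqxx ?orbT.
rewrite (leq_trans _ (_ : #|[set porbit s (rim_up i0); porbit s (rim_down i0)]| <= 2)) //.
  apply/subset_leq_card/subsetP => _ /imsetP[d _ ->]; case: (dartP d) => i; rewrite ?OI ?I0 //.
    by rewrite U0 !inE eqxx.
  by rewrite L0 !inE eqxx orbT.
by rewrite cards2; case: eqP.
Qed.

End WheelDarts.

(** * The number of faces of a random embedding of a wheel *)
Section WheelFaces.
Import mathcomp.boot.fintype mathcomp.boot.finset.
Local Open Scope set_scope.
Local Open Scope ring_scope.
Variable n : nat.
Hypothesis n3 : (3 <= n)%N.
Local Notation W := (wheel n).
Local Notation hub := (hub n).
Local Notation rims := (rims n).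
Implicit Types (r s t : {perm dart W}).

Lemma rotation_hub_rim s : s \in rotation_systems W -> s \in ('N(hub | 'P))%g.
Proof.
move=> /rotation_systemsP sP; apply/stabP => d.
by rewrite !in_hub; have := mem_porbit s 1 d; rewrite expg1 sP inE => /eqP ->.
Qed.

Lemma rim_hub_rotation r s : r \in rims -> perm_on hub s ->
  ((r * s)%g \in rotation_systems W) = full_cycle hub s.
Proof.
move=> rP sH; have := rP; rewrite inE => /andP[rH /forall_inP rC].
have rs_hub d : d \in hub -> porbit (r * s)%g d = porbit s d.
  move=> dH; apply: (eq_in_porbit (S := hub)) (perm_on_stab sH) dH => y yH.
  by rewrite permM (out_perm rH) // inE yH.
have rs_rim d : d \in ~: hub -> porbit (r * s)%g d = porbit r d.
  move=> dH; apply: (eq_in_porbit (S := ~: hub)) (perm_on_stab rH) dH => y yH.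
  by rewrite permM (out_perm sH) // -in_setC perm_closed.
apply/rotation_systemsP/andP => [rsP|[_ /forall_inP sC] d].
  split => //; apply/forall_inP => h hH.
  by rewrite -rs_hub // rsP; move: hH; rewrite in_hub => /eqP ->.
have [dH|dH] := boolP (d \in hub).
  rewrite rs_hub // (eqP (sC _ dH)).
  by move: dH; rewrite in_hub => /eqP ->.
have dC : d \in ~: hub by rewrite in_setC.
by rewrite rs_rim //; exact/eqP/rC.
Qed.

(** The rotation at the hub and those at the rim are chosen independently. *)
Lemma sum_rotation_systems (V : nmodType) (F : {perm dart W} -> V) :
  \sum_(rho in rotation_systems W) F rho =
  \sum_(r in rims) \sum_(s in full_cycles hub) F (r * s)%g.
Proof.
rewrite (partition_big (restr_perm (~: hub)) (mem rims)) /=; last first.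
  move=> s sR; have sN := rotation_hub_rim sR.
  have sNC : s \in ('N(~: hub | 'P))%g by rewrite astabsC.
  rewrite inE restr_perm_on; apply/forall_inP => d dH.
  rewrite (eq_in_porbit (S := ~: hub) (t := s)) //; first by move/rotation_systemsP: sR => ->.
  by move=> y yH; rewrite restr_permE.
apply: eq_bigr => r rP; have := rP; rewrite inE => /andP[rH _].
rewrite (reindex_inj (mulgI r)) /=; apply: eq_bigl => s; rewrite [RHS]inE.
have rNC : r \in ('N(~: hub | 'P))%g by exact: perm_on_stab.
apply/andP/idP => [[rsR /eqP E]|sC].
  have sN : s \in ('N(~: hub | 'P))%g.
    have rsN : (r * s)%g \in ('N(~: hub | 'P))%g by rewrite astabsC; exact: rotation_hub_rim.
    by rewrite -[s](mulKg r) groupM ?groupV.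
  have sH : perm_on hub s.
    apply/subsetP => d; rewrite inE; apply: contraNT => dH.
    have dC : d \in ~: hub by rewrite inE.
    move: E; rewrite restrM // (restr_perm_id rH) => /(canRL (mulKg _)); rewrite mulVg => E.
    by rewrite -[X in X == _](restr_permE sN dC) E perm1.
  by rewrite -(rim_hub_rotation rP sH).
have sH : perm_on hub s by case/andP: sC.
split; first by rewrite rim_hub_rotation.
have sN : s \in ('N(~: hub | 'P))%g by rewrite astabsC perm_on_stab.
by rewrite restrM // restr_perm_id // restr_perm1 ?mulg1 // setCK.
Qed.

Lemma hub_gt0 : (0 < #|hub|)%N. Proof. by rewrite card_hub; lia. Qed.

(** Of the at most two orbits of [ncyc_rim], at least one meets the hub; x is the
    number of those that do not. *)
Lemma rim_faces r : r \in rims -> exists t x,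
  [/\ perm_on hub t, (cyc_in hub t <= 2)%N, (x <= 1)%N &
   forall s, s \in full_cycles hub ->
    nb_faces (r * s)%g = (ncyc (t * s)%g - (#|dart W| - #|hub|) + x)%N /\
    (nb_faces (r * s)%g <= n.+1)%N].
Proof.
move=> rP; have [t [c [tH cm E]]] := shortcut hub (dart_rev_perm W * r)%g.
have k2 := ncyc_rim n3 rP; have dE : (#|dart W| - #|hub|)%N = #|~: hub|.
  by rewrite -(cardsC hub) addKn.
have := E 1%g (perm_on1 _); rewrite !mulg1 (ncyc_perm_on tH) => E1.
have t0 := cyc_in_gt0 tH hub_gt0.
exists t, (#|~: hub| - c)%N; split => //; [lia|lia|move=> s; rewrite inE => /andP[sH _]].
have nE : ncyc (dart_rev_perm W * (r * s))%g = nb_faces (r * s)%g by [].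
have := E s sH; rewrite -mulgA nE.
have tsH : perm_on hub (t * s)%g by exact: perm_onM.
rewrite (ncyc_perm_on tsH) dE; have := cyc_in_le hub (t * s)%g; rewrite (card_hub n3).
lia.
Qed.

Variable R : realFieldType.

Definition face_mean (f : nat -> R) : R :=
  (\sum_(rho in rotation_systems W) f (nb_faces rho)) / #|rotation_systems W|%:R.

(** Conditionally on the rotations at the rim, the number of faces is a number of
    cycles as in [cycle_mean], shifted by x. *)
Lemma face_mean_near (f : nat -> R) v B :
  (forall t x, perm_on hub t -> (cyc_in hub t <= 2)%N -> (x <= 1)%N ->
    `|cycle_mean hub t (fun i => f (i + x)%N) - v| <= B) ->
  `|face_mean f - v| <= B.
Proof.
move=> fB; pose C := #|full_cycles hub|%:R : R.
have cR : #|rotation_systems W|%:R = #|rims|%:R * C.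
  rewrite -sum1_card natr_sum sum_rotation_systems.
  by rewrite /C -natrM -sum_nat_const natr_sum; apply: eq_bigr => r _; rewrite sumr_const.
have R0 : (0 : R) < #|rotation_systems W|%:R.
  by rewrite ltr0n card_gt0; exact: rotation_systems_neq0.
have -> : face_mean f - v = (\sum_(rho in rotation_systems W) (f (nb_faces rho) - v))
     / #|rotation_systems W|%:R.
  by rewrite /face_mean sumrB sumr_const mulrBl -[v *+ _]mulr_natr mulfK // gt_eqF.
rewrite normrM normfV [`|#|_|%:R|]gtr0_norm // ler_pdivrMr // sum_rotation_systems.
rewrite (le_trans (ler_norm_sum _ _ _)) // cR [X in _ <= X](_ : _ = \sum_(r in rims) C * B); last first.
  by rewrite sumr_const -mulr_natl; ring.
apply: ler_sum => r rP; have [t [x [tH t2 x1 E]]] := rim_faces rP.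
have C0 : 0 < C by rewrite ltr0n (full_cycles_gt0 R tH hub_gt0 t2).
rewrite (eq_bigr (fun s => f (ncyc (t * s)%g - (#|dart W| - #|hub|) + x)%N - v)) => [|s sC]; last first.
  by have [-> _] := E s sC.
have -> : \sum_(s in full_cycles hub) (f (ncyc (t * s)%g - (#|dart W| - #|hub|) + x)%N - v) =
    C * (cycle_mean hub t (fun i => f (i + x)%N) - v).
  by rewrite sumrB sumr_const mulrBr /cycle_mean mulrC divfK ?gt_eqF // mulr_natl.
by rewrite normrM gtr0_norm // ler_pM2l // fB.
Qed.

(** The shift x contributes 1 to the constant, and [cycle_mean_lip] 12. *)
Lemma face_mean_lip (f : nat -> R) M : (forall i, `|f i.+1 - f i| <= M) ->
  `|face_mean f - perm_mean n f| <= 13%:R * M.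
Proof.
move=> fM; apply: face_mean_near => t x tH t2 x1.
have gM i : `|f (i.+1 + x)%N - f (i + x)%N| <= M by exact: fM.
have := cycle_mean_lip tH hub_gt0 t2 gM; rewrite (card_hub n3) => H1.
have H2 : `|perm_mean n (fun i => f (i + x)%N) - perm_mean n f| <= M.
  rewrite -mulN1r -perm_mean_comb; apply: perm_mean_norm => i; rewrite mulN1r.
  case: x x1 {gM H1} => [|[|//]] _; rewrite ?addn0 ?addn1 //.
  by rewrite subrr normr0 (le_trans _ (fM 0%N)).
apply: le_trans (ler_distD (perm_mean n (fun i => f (i + x)%N)) _ _) _.
by rewrite (_ : 13%:R * M = 12%:R * M + M); [exact: lerD | ring].
Qed.

Lemma harm_le m : harm R m <= m%:R.
Proof.
rewrite -[m in X in _ <= X]card_ord -sumr_const; apply: ler_sum => i _.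
by rewrite invf_le1 ?ltr0n // ler1n.
Qed.

Lemma harm_ge0 m : 0 <= harm R m.
Proof. by apply: sumr_ge0 => i _; rewrite invr_ge0. Qed.

(** By induction, the sum of the 1/j^2 up to m is at most 2 - 1/m. *)
Lemma harm2_bound m : 0 <= harm2 R m <= 2%:R.
Proof.
rewrite sumr_ge0 => [|i _] //=.
suff : harm2 R m.+1 <= 2%:R - m.+1%:R^-1.
  rewrite /harm2 big_ord_recr /= => H.
  apply: (@le_trans _ _ (2%:R - m.+1%:R^-1 - m.+1%:R^-1 ^+ 2)); first by rewrite lerBrDr.
  by rewrite -addrA gerDl -opprD oppr_le0 addr_ge0.
elim: m => [|m IH]; first by rewrite /harm2 big_ord1 invr1 expr1n; lra.
rewrite /harm2 big_ord_recr /= (le_trans (lerD IH (lexx _))) //.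
have m0 : (0 : R) < m.+1%:R by rewrite ltr0n.
have -> : m.+2%:R = m.+1%:R + 1 :> R by rewrite natr1.
move: m.+1%:R m0 => x x0; rewrite -subr_ge0.
have -> : 2%:R - (x + 1)^-1 - (2%:R - x^-1 + (x + 1)^-1 ^+ 2) = x^-1 * (x + 1)^-1 ^+ 2.
  by field; rewrite !gt_eqF // addr_gt0.
by rewrite mulr_ge0 ?invr_ge0 ?exprn_ge0 ?invr_ge0 ?ltW // addr_gt0.
Qed.

Lemma face_mean_id : `|face_mean (fun i => i%:R) - harm R n| <= 9%:R.
Proof.
apply: face_mean_near => t x tH t2 x1; have := cycle_mean_id R tH hub_gt0 t2.
rewrite (card_hub n3) => H.
have -> : cycle_mean hub t (fun i => (i + x)%:R) = cycle_mean hub t (fun i => i%:R) + x%:R :> R.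
  rewrite (@eq_cycle_mean _ _ _ _ _ (fun i => i%:R + x%:R * 1)) => [|i]; last by rewrite mulr1 natrD.
  by rewrite (cycle_mean_comb _ _ _ (fun=> 1)) (cycle_mean_const tH hub_gt0 t2) mulr1.
have n0 : (0 : R) < n%:R by rewrite ltr0n; lia.
rewrite addrAC; apply: le_trans (ler_normD _ _) _.
rewrite (_ : 9%:R = 8%:R + 1 :> R); last by rewrite natr1.
rewrite lerD // ?normr_nat ?lern1 //; apply: le_trans H _.
by rewrite ler_pdivrMr // ler_peMr // ler1n; lia.
Qed.

(** The centring is at the harmonic number rather than at the mean, so that it is
    the same for all rotations at the rim.  The error 8/n in the mean is
    multiplied by 2 * harm n, which is at most 2 n. *)
Lemma face_mean_var :
  `|face_mean (fun i => (i%:R - harm R n) ^+ 2) - harm R n| <= 59%:R.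
Proof.
apply: face_mean_near => t x tH t2 x1.
have := cycle_mean_id R tH hub_gt0 t2; have := cycle_mean_sq R tH hub_gt0 t2.
rewrite (card_hub n3); set h := harm R n => Hsq Hid.
set m1 := cycle_mean _ _ _ in Hid; set m2 := cycle_mean _ _ _ in Hsq.
have n0 : (0 : R) < n%:R by rewrite ltr0n; lia.
have h0 : 0 <= h by exact: harm_ge0.
have hn : h <= n%:R by exact: harm_le.
have -> : cycle_mean hub t (fun i => ((i + x)%:R - h) ^+ 2) =
   m2 + (2%:R * (x%:R - h)) * m1 + (x%:R - h) ^+ 2 :> R.
  rewrite (@eq_cycle_mean _ _ _ _ _ (fun i => (i%:R ^+ 2 + (2%:R * (x%:R - h)) * i%:R) +
      (x%:R - h) ^+ 2 * 1)) => [|i]; last by rewrite natrD; ring.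
  rewrite (cycle_mean_comb _ _ _ (fun=> 1)) (cycle_mean_const tH hub_gt0 t2) mulr1.
  by rewrite (cycle_mean_comb _ _ (fun i => i%:R ^+ 2)).
have {}Hid : exists2 e, `|e| <= 8%:R / n%:R & m1 = h + e by exists (m1 - h); rewrite // addrC subrK.
have [e eE ->] := Hid.
have [_ g2] := andP (harm2_bound n); have [g0 _] := andP (harm2_bound n).
have e8 : `|e| <= 8%:R by rewrite (le_trans eE) // ler_pdivrMr // ler_peMr // ler1n; lia.
have he : `|h * e| <= 8%:R.
  rewrite normrM (ger0_norm h0) (le_trans (ler_pM h0 (normr_ge0 e) hn eE)) //.
  by rewrite mulrCA mulfV ?gt_eqF // mulr1.
move: Hsq e8 he; rewrite !ler_norml => /andP[q1 q2] /andP[e1 e2] /andP[f1 f2].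
have x01 : x%:R = 0 :> R \/ x%:R = 1 :> R by case: x x1 => [|[|]]; [left|right|].
by case: x01 => ->; apply/andP; split; nra.
Qed.

End WheelFaces.

(** * From faces to genus *)
Section WheelGenus.
Import mathcomp.boot.fintype mathcomp.boot.finset.
Local Open Scope set_scope.
Local Open Scope nat_scope.
Variable n : nat.
Hypothesis n3 : 3 <= n.
Local Notation W := (wheel n).
Implicit Types (rho : {perm dart W}).

Lemma card_edges_wheel : #|edges W| = n.*2.
Proof.
apply: double_inj; rewrite card_edges card_dart_rev_orbits.
rewrite -sum1_card (partition_big (@dart_tail W) xpredT) //=.
rewrite (eq_bigr (fun v : vert W => #|out_darts v|)) => [|v _]; last first.
  by rewrite -sum1_card; apply: eq_bigl => d; rewrite inE.
rewrite (bigD1 None) //= card_hub //.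
rewrite (eq_bigr (fun=> 3)) => [|[i|] // _]; last exact: card_out_darts_rim.
rewrite sum_nat_const (_ : #|_| = n); first by lia.
rewrite -[RHS](card_ord n) -[RHS](card_imset _ (@Some_inj _)); apply: eq_card => v.
apply/idP/imsetP => [|[i _ ->] //]; case: v => [i|] //; by exists i.
Qed.

Definition genus_of rho : nat := (n.+1 - nb_faces rho)./2.

(** By parity and the bound n.+1 on the number of faces, the halving is exact. *)
Lemma genus_ofP rho k : rho \in rotation_systems W ->
  (#|vert W|%:Z - #|edges W|%:Z + (nb_faces rho)%:Z == 2 - 2 * k%:Z)%R = (genus_of rho == k).
Proof.
move=> rP; have := euler_parity (wheel_nonisolated n3) rP.
have : nb_faces rho <= n.+1.
  have : \sum_(s in rotation_systems W) (n.+1 < nb_faces s : nat) == 0.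
    rewrite sum_rotation_systems big1 // => r rR.
    have [t [x [_ _ _ E]]] := rim_faces n3 rR; rewrite big1 // => s /E[_ sn].
    by rewrite ltnNge sn.
  by rewrite sum_nat_eq0 => /forall_inP/(_ rho rP); rewrite eqb0 -leqNgt.
rewrite card_edges_wheel card_option card_ord /genus_of.
move: (nb_faces rho) => F Fn par; apply/eqP/eqP; lia.
Qed.

Lemma genus_numberE k : genus_number W k = #|[set rho in rotation_systems W | genus_of rho == k]|.
Proof.
rewrite /genus_number; apply: eq_card => rho; rewrite !inE.
case: (boolP [forall d, _]) => //= rP; apply: genus_ofP.
by rewrite inE.
Qed.

Lemma genus_of_le rho : genus_of rho <= n.
Proof. by rewrite /genus_of; lia. Qed.

Lemma genus_of_faces rho (R : realFieldType) : rho \in rotation_systems W ->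
  ((genus_of rho)%:R = (n.+1%:R - (nb_faces rho)%:R) / 2%:R :> R)%R.
Proof.
move=> rP; have := genus_ofP (genus_of rho) rP; rewrite eqxx card_edges_wheel card_option card_ord => /eqP E.
have {}E : nb_faces rho + 2 * genus_of rho = n.+1 by lia.
by rewrite -E natrD natrM addrC addKr mulrC mulKf // pnatr_eq0.
Qed.

Lemma sum_genus_number (V : nmodType) (psi : nat -> V) m : n < m ->
  (\sum_(k < m) psi k *+ genus_number W k = \sum_(rho in rotation_systems W) psi (genus_of rho))%R.
Proof.
move=> nm; pose g rho : 'I_m := Ordinal (leq_ltn_trans (genus_of_le rho) nm).
rewrite [RHS](partition_big g xpredT) //=; apply: eq_bigr => k _.
rewrite genus_numberE -sumr_const; apply: eq_big => [rho|rho]; first by rewrite inE -val_eqE.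
by rewrite inE => /andP[_ /eqP ->].
Qed.

Lemma genus_poly_at1 (R : nzRingType) : ((genus_poly R W).[1] = #|rotation_systems W|%:R)%R.
Proof.
rewrite /genus_poly horner_poly card_edges_wheel.
rewrite (eq_bigr (fun k : 'I__ => 1%R *+ genus_number W k)%R) => [|k _]; last by rewrite expr1n mulr1.
by rewrite (sum_genus_number (fun=> 1%R)) ?sumr_const //; lia.
Qed.

End WheelGenus.

(** * Mills ratio *)
Section MillsRatio.
Variables (R : realType) (phi P : R -> R) (K : R).
Implicit Types x y z : R.

Hypothesis dphi : forall x, is_derive x 1 phi (- x * phi x).
Hypothesis dP : forall x, is_derive x 1 P (phi x).
Hypothesis phi_gt0 : forall x, 0 < phi x.
Hypothesis phi_sq : forall x, x ^+ 2 * phi x <= K.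
Hypothesis P_ge0 : forall x, 0 <= P x.
Hypothesis P_cvg : forall e, 0 < e -> exists M, forall y, y <= M -> P y <= e.

Lemma mean_value (f df : R -> R) x y : (forall x, is_derive x 1 f (df x)) -> x <= y ->
  exists2 c, x <= c <= y & f y - f x = df c * (y - x).
Proof.
move=> fd xy; have [c cxy E] : exists2 c, c \in `[x, y]%R & f y - f x = df c * (y - x).
  apply: MVT_segment => // c; apply: derivable_within_continuous => u _.
  by have := fd u => -[].
by exists c => //; move: cxy; rewrite in_itv.
Qed.

Lemma nondecreasing_ge0 (f df : R -> R) b : (forall x, is_derive x 1 f (df x)) ->
  (forall x, x <= b -> 0 <= df x) ->
  (forall e, 0 < e -> exists M, forall y, y <= M -> - e <= f y) ->
  forall x, x <= b -> 0 <= f x.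
Proof.
move=> fd df0 flow x xb; rewrite leNgt; apply/negP => fx0.
have e0 : 0 < - f x / 2%:R by rewrite divr_gt0 // oppr_gt0.
have [M fM] := flow _ e0; pose y := Num.min M x.
have yM : y <= M by rewrite ge_min lexx.
have yx : y <= x by rewrite ge_min lexx orbT.
have [c /andP[_ cx] E] := mean_value fd yx.
have : 0 <= f x - f y by rewrite E mulr_ge0 ?subr_ge0 // df0 // (le_trans cx).
by have := fM y yM; lra.
Qed.

Lemma xphi_small e : 0 < e -> exists M, forall y, y <= M -> - e <= y * phi y.
Proof.
move=> e0; exists (Num.min (-1) (- (K / e))) => y; rewrite le_min => /andP[y1 yK].
have y0 : 0 < - y by lra.
have H := phi_sq y; have p0 := phi_gt0 y.
have : K / e <= - y by lra.
rewrite ler_pdivrMr // => H2.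
have : (- y) * (- y * phi y) <= (- y) * e by rewrite expr2 in H; nra.
by rewrite ler_pM2l //; lra.
Qed.

(** The difference phi - P has derivative - (x + 1) phi x and limit 0 at -oo. *)
Lemma tail_le_phi x : x <= -1 -> P x <= phi x.
Proof.
move=> x1; rewrite -subr_ge0; have := @nondecreasing_ge0 (fun x => phi x - P x)
  (fun x => - x * phi x - phi x) (-1); apply => //.
- by move=> u u1; have := phi_gt0 u; nra.
- move=> e /P_cvg[M PM]; exists M => y /PM; have := phi_gt0 y; lra.
Qed.

(** The derivative is P x, and the limit at -oo is 0, because P is at most phi
    there. *)
Lemma mills_upper x : 0 <= phi x + x * P x.
Proof.
have := @nondecreasing_ge0 (fun x => phi x + x * P x) P x; apply => // [u|e e0].
  apply: is_derive_eq; rewrite /GRing.scale /=; ring.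
have [M HM] := xphi_small e0; exists (Num.min (-1) M) => y; rewrite le_min => /andP[y1 /HM].
by have := tail_le_phi y1; have := phi_gt0 y; nra.
Qed.

(** The derivative is twice the quantity of [mills_upper]. *)
Lemma mills_lower x : 0 <= (1 + x ^+ 2) * P x + x * phi x.
Proof.
have := @nondecreasing_ge0 (fun x => (1 + x ^+ 2) * P x + x * phi x)
  (fun x => 2%:R * (phi x + x * P x)) x; apply => // [u|u _|e e0].
- apply: is_derive_eq; rewrite /GRing.scale /=; ring.
- by rewrite mulr_ge0 // mills_upper.
- have [M HM] := xphi_small e0; exists M => y /HM.
  by have := P_ge0 y; have := sqr_ge0 y; nra.
Qed.

(** In terms of this ratio, the two inequalities above say that its first two
    derivatives are nonnegative. *)
Definition mills x := P x / phi x.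

Lemma is_derive_mills x : is_derive x 1 mills (1 + x * mills x).
Proof.
have p0 : phi x != 0 by rewrite gt_eqF.
have dV := is_deriveV p0 (dphi x).
apply: is_derive_eq; rewrite /GRing.scale /= /mills.
by field.
Qed.

Definition mills1 x := 1 + x * mills x.

Lemma is_derive_mills1 x : is_derive x 1 mills1 ((1 + x ^+ 2) * mills x + x).
Proof.
have dm := is_derive_mills; rewrite /mills1.
apply: is_derive_eq; rewrite /GRing.scale /=; ring.
Qed.

Lemma mills_ge0 x : 0 <= mills x.
Proof. by rewrite divr_ge0 // ltW. Qed.

Lemma mills1_ge0 x : 0 <= mills1 x.
Proof.
have -> : mills1 x = (phi x + x * P x) / phi x.
  by rewrite /mills1 /mills mulrDl divff ?gt_eqF // mulrA.
by rewrite divr_ge0 ?mills_upper // ltW.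
Qed.

Lemma mills2_ge0 x : 0 <= (1 + x ^+ 2) * mills x + x.
Proof.
have -> : (1 + x ^+ 2) * mills x + x = ((1 + x ^+ 2) * P x + x * phi x) / phi x.
  by rewrite /mills; field; rewrite gt_eqF.
by rewrite divr_ge0 ?mills_lower // ltW.
Qed.

Lemma le_mills x y : x <= y -> mills x <= mills y.
Proof.
move=> xy; have [c _ E] := mean_value is_derive_mills xy.
by rewrite -subr_ge0 E mulr_ge0 ?subr_ge0 // mills1_ge0.
Qed.

Lemma le_mills1 x y : x <= y -> mills1 x <= mills1 y.
Proof.
move=> xy; have [c _ E] := mean_value is_derive_mills1 xy.
by rewrite -subr_ge0 E mulr_ge0 ?subr_ge0 // mills2_ge0.
Qed.

(** As the ratio and its derivative are nondecreasing, they are bounded on the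
    left of z by their values at z; so is the second derivative, which equals
    mills x + x * mills1 x. *)
Lemma mills_expansion z : exists2 C, 0 <= C & forall x, x <= z ->
  [/\ `|mills x| <= C, `|mills1 x| <= C,
   forall y, y <= z -> `|mills1 y - mills1 x| <= C * `|y - x| &
   forall y, y <= z -> `|mills y - mills x - (y - x) * mills1 x| <= C * (y - x) ^+ 2].
Proof.
pose C := mills z + (1 + `|z|) * mills1 z.
have m1 := mills1_ge0; have m0 := mills_ge0.
have Cm x : x <= z -> 0 <= (1 + x ^+ 2) * mills x + x <= C.
  move=> xz; rewrite mills2_ge0 /=.
  have -> : (1 + x ^+ 2) * mills x + x = mills x + x * mills1 x by rewrite /mills1; ring.
  have := le_mills xz; have := le_mills1 xz; have := m1 x; have := m1 z; have := ler_norm z.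
  have := normr_ge0 z; rewrite /C; nra.
have C0 : 0 <= C by have := m1 z; have := m0 z; have := normr_ge0 z; rewrite /C; nra.
have zC : mills z <= C by have := m1 z; have := normr_ge0 z; rewrite /C; nra.
have z1C : mills1 z <= C by have := m1 z; have := m0 z; have := normr_ge0 z; rewrite /C; nra.
have L x y : x <= z -> y <= z -> `|mills1 y - mills1 x| <= C * `|y - x|.
  wlog xy : x y / x <= y.
    move=> W xz yz; have [xy|/ltW yx] := leP x y; first exact: W.
    by rewrite distrC [`|y - x|]distrC; exact: W.
  move=> xz yz; have [c /andP[xc cy] E] := mean_value is_derive_mills1 xy.
  have [c0 cC] := andP (Cm c (le_trans cy yz)).
  by rewrite E normrM (ger0_norm c0) ler_wpM2r.
exists C => // x xz; split.
- by rewrite ger0_norm // (le_trans (le_mills xz)).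
- by rewrite ger0_norm // (le_trans (le_mills1 xz)).
- by move=> y yz; exact: L.
move=> y yz.
have [c [cz cx E]] : exists c, [/\ c <= z, `|c - x| <= `|y - x| & mills y - mills x = mills1 c * (y - x)].
  have [xy|/ltW yx] := leP x y.
    have [c /andP[xc cy] E] := mean_value is_derive_mills xy.
    exists c; split => //; first exact: le_trans yz.
    by rewrite !ger0_norm ?subr_ge0 // lerB.
  have [c /andP[yc cx] E] := mean_value is_derive_mills yx.
  exists c; split => //; first exact: le_trans xz.
    by rewrite distrC [`|y - x|]distrC !ger0_norm ?subr_ge0 // lerB.
  by rewrite -opprB E -mulrN opprB.
rewrite E [(y - x) * _]mulrC -mulrBl normrM -[(y - x) ^+ 2]ger0_norm ?sqr_ge0 // normrX expr2 mulrA.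
rewrite ler_wpM2r // (le_trans (L _ _ xz cz)) // ler_wpM2l //.
Qed.

End MillsRatio.

(** * The standard normal distribution function *)
Section NormalDistribution.
Variable R : realType.
Implicit Types x y z e : R.
Local Open Scope ring_scope.

Local Notation phi := (normal_pdf (0 : R) 1).

Definition normal_cdf x : R := fine (normal_prob (0 : R) 1 `]-oo, x]).

Lemma normal_pdf_std x : phi x = normal_peak 1 * expR (- x ^+ 2 / 2%:R).
Proof.
by rewrite normal_pdfE ?oner_neq0 // /normal_fun subr0 expr1n.
Qed.

Lemma normal_pdf_std_gt0 x : 0 < phi x.
Proof. by rewrite normal_pdf_std mulr_gt0 ?expR_gt0 ?normal_peak_gt0 ?oner_neq0. Qed.

Lemma is_derive_normal_pdf x : is_derive x 1 phi (- x * phi x).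
Proof.
rewrite (_ : phi = fun x => normal_peak 1 * expR (- x ^+ 2 / 2%:R)); last first.
  by apply/funext => u; exact: normal_pdf_std.
apply: is_derive_eq; rewrite /GRing.scale /=.
by move: (expR _) (normal_peak _) => u v; field.
Qed.

Lemma normal_pdf_sq x : x ^+ 2 * phi x <= 2%:R * normal_peak 1.
Proof.
rewrite normal_pdf_std mulrCA mulrC ler_wpM2r ?normal_peak_ge0 //.
have := expR_ge1Dx (x ^+ 2 / 2%:R); rewrite mulNr expRN => H.
by rewrite ler_pdivrMr ?expR_gt0 //; lra.
Qed.

Lemma normal_cdfE x : normal_prob (0 : R) 1 `]-oo, x] = (normal_cdf x)%:E.
Proof. by rewrite fineK // fin_num_measure. Qed.

Lemma normal_cdf_ge0 x : 0 <= normal_cdf x.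
Proof. by rewrite -lee_fin -normal_cdfE measure_ge0. Qed.

Lemma normal_cdf_le1 x : normal_cdf x <= 1.
Proof. by rewrite -lee_fin -normal_cdfE probability_le1. Qed.

Lemma is_derive_normal_cdf x : is_derive x 1 normal_cdf (phi x).
Proof.
have xu : x < x + 1 by rewrite ltrDl.
have fi : lebesgue_measure.-integrable [set` Interval -oo%O (BRight (x + 1))] (EFin \o phi).
  by apply: integrableS (integrable_normal_pdf 0 1).
have cx : {for x, continuous phi} by apply: continuous_normal_pdf; exact: oner_neq0.
have [dF E] := continuous_FTC1 xu fi (ltNyr _) cx.
by apply: DeriveDef => //; rewrite -derive1E.
Qed.

Let idR : measurableTypeR R -> R := idfun.
HB.instance Definition _ := @isMeasurableFun.Build _ _ _ _ idR (@measurable_id _ _ setT).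

Lemma normal_cdf_lim e : 0 < e -> exists M, forall y,
  (y <= - M -> normal_cdf y <= e) /\ (M <= y -> 1 - normal_cdf y <= e).
Proof.
move=> e0; pose X := idR : {RV (normal_prob (0 : R) 1) >-> R}.
have cE : fine \o cdf X = normal_cdf by [].
have /fine_cvgP[_] := cvg_cdfNy0 X; have /fine_cvgP[_] := cvg_cdfy1 X.
rewrite cE => /cvgrPdist_le/(_ e e0) [M1 [_ H1]] /cvgrPdist_le/(_ e e0) [M2 [_ H2]].
exists (Num.max (M1 + 1) (1 - M2)) => y; split => yM.
  have /H2 : y < M2.
    have : 1 - M2 <= Num.max (M1 + 1) (1 - M2) by rewrite le_max lexx orbT.
    lra.
  by rewrite /= sub0r normrN ger0_norm // normal_cdf_ge0.
have /H1 : M1 < y.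
  have : M1 + 1 <= Num.max (M1 + 1) (1 - M2) by rewrite le_max lexx.
  lra.
by move=> /(le_trans (ler_norm _)).
Qed.

End NormalDistribution.

(** * The Stein equation for hinge functions *)
Section Stein.
Variable R : realType.
Implicit Types x y z : R.
Local Notation phi := (normal_pdf (0 : R) 1).
Local Notation Phi := (@normal_cdf R).

(** The mean of max (0, z - N) for a standard normal variable N. *)
Definition normal_hinge z : R := z * Phi z + phi z.

(** First-order expansions with quadratic error survive gluing at a point where
    values and slopes agree: between points on both sides, expand at z, and use
    that the slopes are Lipschitz. *)
Lemma quadratic_glue (a da b db : R -> R) z K : a z = b z -> da z = db z ->
  (forall x y, x <= z -> y <= z -> `|a y - a x - (y - x) * da x| <= K * (y - x) ^+ 2) ->
  (forall x y, x <= z -> y <= z -> `|da y - da x| <= K * `|y - x|) ->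
  (forall x y, z <= x -> z <= y -> `|b y - b x - (y - x) * db x| <= K * (y - x) ^+ 2) ->
  (forall x y, z <= x -> z <= y -> `|db y - db x| <= K * `|y - x|) ->
  forall x y, `|(if y <= z then a y else b y) - (if x <= z then a x else b x)
     - (y - x) * (if x <= z then da x else db x)| <= 3%:R * K * (y - x) ^+ 2.
Proof.
move=> abz dabz Qa La Qb Lb x y; have zz := lexx z.
have K0 : 0 <= K.
  have zz1 : z <= z + 1 by rewrite lerDl.
  have := Lb z (z + 1) zz zz1; rewrite (_ : z + 1 - z = 1) ?normr1 ?mulr1; last by ring.
  exact: le_trans.
have [xz|/ltW zx] := leP x z; have [yz|/ltW zy] := leP y z.
- apply: le_trans (Qa _ _ xz yz) _; have := sqr_ge0 (y - x); nra.
- have := Qa x z xz zz; have := Qb z y zz zy; have := La x z xz zz.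
  rewrite -abz -dabz [`|z - x|]ger0_norm ?subr_ge0 // !ler_norml.
  move: (a z) (a x) (b y) (da z) (da x) => az ax by' dz dx.
  move=> /andP[h1 h2] /andP[h3 h4] /andP[h5 h6].
  have u0 : 0 <= z - x by rewrite subr_ge0.
  have v0 : 0 <= y - z by rewrite subr_ge0.
  move: h1 h2 h3 h4 h5 h6; have -> : y - x = (z - x) + (y - z) by ring.
  move: (z - x) (y - z) u0 v0 => u v u0 v0 h1 h2 h3 h4 h5 h6.
  have vh1 := ler_wpM2l v0 h1; have vh2 := ler_wpM2l v0 h2.
  have uv := mulr_ge0 u0 v0; have Kuv := mulr_ge0 K0 uv.
  have Ku := mulr_ge0 K0 (sqr_ge0 u); have Kv := mulr_ge0 K0 (sqr_ge0 v).
  by apply/andP; split; lra.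
- have := Qb x z zx zz; have := Qa z y zz yz; have := Lb x z zx zz.
  rewrite abz dabz [`|z - x|]ler0_norm ?subr_le0 // !ler_norml.
  move: (b z) (b x) (a y) (db z) (db x) => az ax by' dz dx.
  move=> /andP[h1 h2] /andP[h3 h4] /andP[h5 h6].
  have u0 : 0 <= x - z by rewrite subr_ge0.
  have v0 : 0 <= z - y by rewrite subr_ge0.
  move: h1 h2 h3 h4 h5 h6; have -> : y - x = - ((x - z) + (z - y)) by ring.
  rewrite -(opprB x z) -(opprB z y).
  move: (x - z) (z - y) u0 v0 => u v u0 v0 h1 h2 h3 h4 h5 h6.
  have vh1 := ler_wpM2l v0 h1; have vh2 := ler_wpM2l v0 h2.
  have uv := mulr_ge0 u0 v0; have Kuv := mulr_ge0 K0 uv.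
  have Ku := mulr_ge0 K0 (sqr_ge0 u); have Kv := mulr_ge0 K0 (sqr_ge0 v).
  by apply/andP; split; lra.
- apply: le_trans (Qb _ _ zx zy) _; have := sqr_ge0 (y - x); nra.
Qed.

Lemma normal_pdfN x : phi (- x) = phi x.
Proof. by rewrite !normal_pdf_std sqrrN. Qed.

(** On the left of z, the solution is 1 + (z - G) Phi / phi, where G is
    [normal_hinge z]; on the right it is G (1 - Phi) / phi.  Both are expressed
    by Mills ratios, of Phi and of its reflection, that stay bounded on the side
    where they are used.  They agree at z by the value of G, and their slopes
    agree there because both solve the equation. *)
Lemma stein_solution z : exists g dg : R -> R, exists C, [/\ 0 <= C,
  forall x, dg x - x * g x = Num.max 0 (z - x) - normal_hinge z,
  forall x, `|g x| <= C, forall x, `|dg x| <= C &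
  forall x y, `|g y - g x - (y - x) * dg x| <= C * (y - x) ^+ 2].
Proof.
pose Q x := 1 - Phi (- x).
have dQ x : is_derive x 1 Q (phi x).
  rewrite -normal_pdfN /Q; have dP := is_derive_normal_cdf (- x).
  apply: is_derive_eq; rewrite /GRing.scale /=; ring.
have Q0 x : 0 <= Q x by rewrite subr_ge0 normal_cdf_le1.
have Plim e : 0 < e -> exists M, forall y, y <= M -> Phi y <= e.
  by move=> /normal_cdf_lim[M HM]; exists (- M) => y yM; apply: (HM y).1.
have Qlim e : 0 < e -> exists M, forall y, y <= M -> Q y <= e.
  move=> /normal_cdf_lim[M HM]; exists (- M) => y yM; apply: (HM (- y)).2.
  by rewrite lerNr.
have dphi := @is_derive_normal_pdf R; have phi0 := @normal_pdf_std_gt0 R.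
have phi2 := @normal_pdf_sq R.
have [C1 C1_0 H1] := mills_expansion dphi (@is_derive_normal_cdf R) phi0 phi2 (@normal_cdf_ge0 R) Plim z.
have [C2 C2_0 H2] := mills_expansion dphi dQ phi0 phi2 Q0 Qlim (- z).
set m1 := mills phi Phi in H1; set m2 := mills phi Q in H2.
set d1 := mills1 phi Phi in H1; set d2 := mills1 phi Q in H2.
pose G := normal_hinge z; pose c := z - G.
pose a x := 1 + c * m1 x; pose da x := c * d1 x.
pose b x := G * m2 (- x); pose db x := - G * d2 (- x).
have phiz := phi0 z.
have abz : a z = b z.
  rewrite /a /b /c /m1 /m2 /mills /G /normal_hinge /Q opprK normal_pdfN.
  by field; rewrite gt_eqF.
have da_a x : da x - x * a x = z - x - G by rewrite /da /a /d1 /mills1 -/m1 /c; ring.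
have db_b x : db x - x * b x = - G by rewrite /db /b /d2 /mills1 -/m2; ring.
have dabz : da z = db z.
  have := da_a z; have := db_b z; rewrite abz; lra.
pose K := `|c| * C1 + `|G| * C2.
have cK : `|c| * C1 <= K by rewrite lerDl mulr_ge0.
have GK : `|G| * C2 <= K by rewrite lerDr mulr_ge0.
have K0 : 0 <= K by apply: le_trans cK; rewrite mulr_ge0.
exists (fun x => if x <= z then a x else b x), (fun x => if x <= z then da x else db x), (1 + 3%:R * K).
split.
- lra.
- move=> x; case: ifP => [xz|/negbT]; first by rewrite da_a max_r // subr_ge0.
  by rewrite -ltNge => zx; rewrite db_b max_l ?sub0r // subr_le0 ltW.
- move=> x; have [xz|/ltW zx] := leP x z.
    have [H _ _ _] := H1 x xz; rewrite /a (le_trans (ler_normD _ _)) // normr1 normrM.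
    by have := ler_wpM2l (normr_ge0 c) H; lra.
  have xz : - x <= - z by rewrite lerN2.
  by have [H _ _ _] := H2 (- x) xz; rewrite /b normrM; have := ler_wpM2l (normr_ge0 G) H; lra.
- move=> x; have [xz|/ltW zx] := leP x z.
    have [_ H _ _] := H1 x xz; rewrite /da normrM.
    by have := ler_wpM2l (normr_ge0 c) H; lra.
  have xz : - x <= - z by rewrite lerN2.
  by have [_ H _ _] := H2 (- x) xz; rewrite /db normrM normrN; have := ler_wpM2l (normr_ge0 G) H; lra.
- move=> x y; apply: le_trans (@quadratic_glue a da b db z K abz dabz _ _ _ _ x y) _.
  + move=> u v uz vz; have [_ _ _ H] := H1 u uz.
    have -> : a v - a u - (v - u) * da u = c * (m1 v - m1 u - (v - u) * d1 u) by rewrite /a /da; ring.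
    rewrite normrM; apply: le_trans (ler_wpM2l (normr_ge0 c) (H v vz)) _.
    by rewrite mulrA ler_wpM2r ?sqr_ge0.
  + move=> u v uz vz; have [_ _ H _] := H1 u uz.
    rewrite /da -mulrBr normrM; apply: le_trans (ler_wpM2l (normr_ge0 c) (H v vz)) _.
    by rewrite mulrA ler_wpM2r.
  + move=> u v zu zv; have uz : - u <= - z by rewrite lerN2.
    have vz : - v <= - z by rewrite lerN2.
    have [_ _ _ H] := H2 (- u) uz.
    have -> : b v - b u - (v - u) * db u = G * (m2 (- v) - m2 (- u) - (- v - - u) * d2 (- u)).
      by rewrite /b /db; ring.
    rewrite normrM; apply: le_trans (ler_wpM2l (normr_ge0 G) (H _ vz)) _.
    have -> : (- v - - u) ^+ 2 = (v - u) ^+ 2 by ring.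
    by rewrite mulrA ler_wpM2r ?sqr_ge0.
  + move=> u v zu zv; have uz : - u <= - z by rewrite lerN2.
    have vz : - v <= - z by rewrite lerN2.
    have [_ _ H _] := H2 (- u) uz.
    rewrite /db -mulrBr normrM normrN; apply: le_trans (ler_wpM2l (normr_ge0 G) (H _ vz)) _.
    by rewrite mulrA (_ : `|- v - - u| = `|v - u|) ?ler_wpM2r // -opprD normrN.
  + by rewrite ler_wpM2r ?sqr_ge0 //; lra.
Qed.

(** The derivative of [normal_hinge] is the distribution function. *)
Lemma normal_hinge_slope x (e : R) : 0 < e ->
  Phi x <= (normal_hinge (x + e) - normal_hinge x) / e <= Phi (x + e).
Proof.
move=> e0; have dh (u : R) : is_derive u 1 normal_hinge (Phi u).
  have d1 := @is_derive_normal_cdf R; have d2 := @is_derive_normal_pdf R.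
  rewrite /normal_hinge; apply: is_derive_eq; rewrite /GRing.scale /=; ring.
have xe : x <= x + e by rewrite lerDl ltW.
have mono u v : u <= v -> Phi u <= Phi v.
  move=> uv; have [w _ E] := mean_value (@is_derive_normal_cdf R) uv.
  by rewrite -subr_ge0 E mulr_ge0 ?subr_ge0 // ltW // normal_pdf_std_gt0.
have [w /andP[xw we] ->] := mean_value dh xe.
by rewrite (_ : x + e - x = e) ?mulfK ?gt_eqF ?mono //; ring.
Qed.
End Stein.

(** * Normal approximation for the number of faces *)
Section SteinForFaces.
Variable R : realType.
Local Open Scope ring_scope.

Lemma hinge_lip (x y : R) : `|Num.max 0 x - Num.max 0 y| <= `|x - y|.
Proof.
have := ler_norm (x - y); have := ler_norm (y - x); rewrite distrC => h1 h2.
by rewrite ler_norml; case: (leP 0 x) => hx; case: (leP 0 y) => hy; apply/andP; split; lra.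
Qed.

(** Write max (0, z - w) - G as dg w - w * g w by the Stein equation, and pass
    from faces to cycles of uniform permutations by [face_mean_lip].  The
    Chen-Stein identity turns the mean of i * f i, with f i = g (w i), into
    harm n times that of f (i + 1), and w (i + 1) = w i - del, so that the
    expansion of g produces - del * dg.  The two main terms cancel when
    del^2 * harm n is close to 1 and m is close to harm n. *)
Lemma face_mean_hinge z : exists2 C : R, 0 <= C & forall n (m del : R), (3 <= n)%N -> 0 < del ->
  `|face_mean n (fun i => Num.max 0 (z - (m - i%:R) * del)) - normal_hinge z| <=
  13%:R * del + C * (`|1 - del ^+ 2 * harm R n| + del * `|m - harm R n| +
     del ^+ 3 * harm R n + 2%:R * (del ^+ 2 + del ^+ 3)).
Proof.
have [g [dg [C [C0 gE gC dgC gQ]]]] := stein_solution z.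
exists C => // n m del n3 del0; set H := harm R n; set G := normal_hinge z.
have H0 : 0 <= H := harm_ge0 R n.
have d0 : 0 <= del := ltW del0.
have [h2_0 h2_2] := andP (harm2_bound R n).
pose w (i : nat) : R := (m - i%:R) * del; pose f i := g (w i).
pose hg i := Num.max 0 (z - w i).
have wS i : w i.+1 = w i - del by rewrite /w -natr1; ring.
have hgl i : `|hg i.+1 - hg i| <= del.
  apply: le_trans (hinge_lip _ _) _; rewrite wS.
  by rewrite (_ : z - (w i - del) - (z - w i) = del) ?gtr0_norm //; ring.
have H1 := face_mean_lip n3 hgl.
pose E i := f i.+1 - f i + del * dg (w i).
have EC i : `|E i| <= C * del ^+ 2.
  rewrite /E /f wS; have := gQ (w i) (w i - del).
  rewrite (_ : w i - del - w i = - del) ?sqrrN ?mulNr ?opprK //; ring.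
pose M := C * del ^+ 2 + C * del.
have fM i : `|f i.+1 - f i| <= M.
  have -> : f i.+1 - f i = E i - del * dg (w i) by rewrite /E; ring.
  apply: le_trans (ler_normB _ _) _; rewrite lerD // normrM gtr0_norm // mulrC.
  by rewrite ler_wpM2r.
have HS := perm_mean_stein n fM.
set S := perm_mean n (fun i => i%:R * f i) in HS.
pose U := perm_mean n (fun i => dg (w i)); pose F := perm_mean n f; pose e := perm_mean n E.
have eC : `|e| <= C * del ^+ 2 by exact: perm_mean_norm.
have UC : `|U| <= C by apply: perm_mean_norm => i.
have FC : `|F| <= C by apply: perm_mean_norm => i; exact: gC.
have fS : perm_mean n (fun i => f i.+1) = F - del * U + e.
  rewrite (@eq_perm_mean _ _ _ (fun i => (f i + - del * dg (w i)) + 1 * E i)); last first.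
    by move=> i; rewrite /E; ring.
  by rewrite (perm_mean_comb _ (fun i => f i + - del * dg (w i))) perm_mean_comb mul1r mulNr.
rewrite fS in HS.
have hgE : perm_mean n hg - G = U - del * m * F + del * S.
  have -> : perm_mean n hg = perm_mean n (fun i => ((dg (w i) + - (del * m) * f i) + del * (i%:R * f i)) + G * 1).
    apply: eq_perm_mean => i; have := gE (w i); rewrite /hg /f -/G => /esym/(canRL (subrK _)) ->.
    by rewrite {2}/w; ring.
  rewrite (perm_mean_comb _ _ (fun=> 1)) perm_mean_const.
  rewrite (perm_mean_comb _ (fun i => dg (w i) + - (del * m) * f i)) perm_mean_comb.
  by rewrite -/U -/F -/S; ring.
have main : U - del * m * F + del * S =
  U * (1 - del ^+ 2 * H) - del * (m - H) * F + del * H * e + del * (S - H * (F - del * U + e)) by ring.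
have -> : face_mean n hg - G = (face_mean n hg - perm_mean n hg) + (perm_mean n hg - G) by ring.
apply: le_trans (ler_normD _ _) _; apply: lerD => //; rewrite hgE main.
have n1 : `|U * (1 - del ^+ 2 * H)| <= C * `|1 - del ^+ 2 * H| by rewrite normrM ler_wpM2r.
have n2 : `|del * (m - H) * F| <= C * (del * `|m - H|).
  rewrite normrM (normrM del) (gtr0_norm del0) [X in X <= _]mulrC.
  by apply: ler_wpM2r => //; exact: mulr_ge0.
have n3' : `|del * H * e| <= C * (del ^+ 3 * H).
  rewrite normrM (normrM del) (gtr0_norm del0) (ger0_norm H0).
  rewrite [X in _ <= X](_ : _ = del * H * (C * del ^+ 2)); last by ring.
  by rewrite ler_wpM2l // mulr_ge0.
have n4 : `|del * (S - H * (F - del * U + e))| <= C * (2%:R * (del ^+ 2 + del ^+ 3)).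
  rewrite normrM (gtr0_norm del0) [X in _ <= X](_ : _ = del * (2%:R * M)); last by rewrite /M; ring.
  rewrite ler_wpM2l // (le_trans HS) // ler_wpM2r //.
  by rewrite addr_ge0 ?mulr_ge0 ?exprn_ge0.
rewrite 3!(mulrDr C); apply: le_trans (ler_normD _ _) (lerD _ n4).
by apply: le_trans (ler_normD _ _) (lerD (le_trans (ler_normB _ _) (lerD n1 n2)) n3').
Qed.
End SteinForFaces.

(** * Asymptotics of the mean and of the variance *)
Section Asymptotics.
Variable R : realType.
Local Open Scope ring_scope.

Lemma harm_ln n : (0 < n)%N -> ln n%:R <= harm R n <= 1 + ln n%:R.
Proof.
case: n => // n _; apply/andP; split.
  apply: (@le_trans _ _ (ln n.+2%:R)); first by rewrite ler_ln ?posrE ?ltr0n // ler_nat.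
  elim: n.+1 => [|m IH]; first by rewrite ln1 harm_ge0.
  rewrite /harm big_ord_recr /= -/(harm R m).
  have m0 : (0 : R) < m.+1%:R by rewrite ltr0n.
  have -> : m.+2%:R = m.+1%:R * (1 + m.+1%:R^-1) :> R.
    by rewrite mulrDr mulr1 divff ?gt_eqF // natr1.
  rewrite lnM ?posrE // ?addr_gt0 ?invr_gt0 // lerD //.
  by apply: le_ln1Dx; rewrite (@lt_trans _ _ 0) ?invr_gt0 // ltrN10.
elim: n => [|m IH]; first by rewrite /harm big_ord1 ln1 invr1 addr0.
rewrite /harm big_ord_recr /= -/(harm R m.+1).
have m0 : (0 : R) < m.+1%:R by rewrite ltr0n.
have m1 : (0 : R) < m.+2%:R by rewrite ltr0n.
have E : m.+1%:R = m.+2%:R * (1 + - m.+2%:R^-1) :> R.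
  by rewrite mulrDr mulr1 mulrN divff ?gt_eqF // -[m.+2%:R]natr1 addrK.
have lt1 : (-1 : R) < - m.+2%:R^-1 by rewrite ltrN2 invf_lt1 // ltr1n.
have := le_ln1Dx lt1; have : ln m.+1%:R = ln m.+2%:R + ln (1 + - m.+2%:R^-1) :> R.
  by rewrite {1}E lnM ?posrE // subr_gt0 invf_lt1 // ltr1n.
move: IH; clear; move: (ln (1 - _)) => c; move: (ln m.+1%:R) (ln m.+2%:R) => a b.
by move: (harm R m.+1) (m.+2%:R^-1) => h x; lra.
Qed.

Lemma ln_nat_infty (A : R) : \forall n \near \oo, A <= ln n%:R.
Proof.
have H := nbhs_infty_ger (expR A); near=> n.
have An : expR A <= n%:R by near: n.
by rewrite -[A]expRK ler_ln ?posrE ?expR_gt0 // (lt_le_trans (expR_gt0 A)).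
Unshelve. all: by end_near. Qed.

(** Cesaro means of the harmonic sequence tend to 0. *)
Lemma harm_sublinear (e : R) : 0 < e -> \forall n \near \oo, harm R n <= e * n%:R.
Proof.
move=> e0; have := cesaro (@cvg_harmonic R) => /cvgrPdist_le/(_ e e0) [N _ HN].
exists N.+1 => // -[|n] //= Nn; have := HN n Nn.
rewrite /arithmetic_mean /= sub0r normrN.
have -> : series harmonic n.+1 = harm R n.+1 by rewrite /series /= big_mkord.
by rewrite ger0_norm ?mulr_ge0 ?invr_ge0 ?harm_ge0 // mulrC ler_pdivrMr // ltr0n.
Qed.

Definition faces_mean n : R := face_mean n (fun i => i%:R).
Definition faces_var n : R := face_mean n (fun i => (i%:R - faces_mean n) ^+ 2).

Lemma card_rotation_gt0 n : (0 : R) < #|rotation_systems (wheel n)|%:R.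
Proof. by rewrite ltr0n card_gt0; exact: rotation_systems_neq0. Qed.

Lemma face_mean_comb n (f g : nat -> R) c :
  face_mean n (fun i => f i + c * g i) = face_mean n f + c * face_mean n g.
Proof. by rewrite /face_mean big_split -mulr_sumr mulrDl mulrA. Qed.

Lemma face_mean_const n (c : R) : face_mean n (fun=> c) = c.
Proof.
by rewrite /face_mean sumr_const -[c *+ _]mulr_natr mulfK // gt_eqF ?card_rotation_gt0.
Qed.

Lemma eq_face_mean n (f g : nat -> R) : f =1 g -> face_mean n f = face_mean n g.
Proof. by move=> fg; rewrite /face_mean; congr (_ / _); apply: eq_bigr => s _; rewrite fg. Qed.

Lemma face_mean_le n (f g : nat -> R) : (forall i, f i <= g i) -> face_mean n f <= face_mean n g.
Proof.
by move=> fg; rewrite /face_mean ler_pM2r ?invr_gt0 ?card_rotation_gt0 //; apply: ler_sum.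
Qed.

Lemma faces_mean_harm n : (3 <= n)%N -> `|faces_mean n - harm R n| <= 9%:R.
Proof. by move=> n3; exact: (face_mean_id n3 R). Qed.

(** The constant is 59 + 9^2: [face_mean_var] is centred at harm n, which differs
    from the mean by at most 9. *)
Lemma faces_var_harm n : (3 <= n)%N -> `|faces_var n - harm R n| <= 140%:R.
Proof.
move=> n3; have Hm := faces_mean_harm n3; have Hv := face_mean_var n3 R.
have -> : faces_var n = face_mean n (fun i => (i%:R - harm R n) ^+ 2) - (faces_mean n - harm R n) ^+ 2.
  set h := harm R n; set m := faces_mean n.
  rewrite /faces_var (@eq_face_mean _ _ (fun i => ((i%:R - h) ^+ 2 + (2%:R * (h - m)) * i%:R) + (m ^+ 2 - h ^+ 2) * 1)).
    rewrite (face_mean_comb _ _ (fun=> 1)) face_mean_const (face_mean_comb _ (fun i => (i%:R - h) ^+ 2)).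
    by rewrite -/(faces_mean n) -/m; ring.
  by move=> i; rewrite -/m; ring.
have : (faces_mean n - harm R n) ^+ 2 <= 81%:R.
  by move: Hm; rewrite ler_norml => /andP[h1 h2]; nra.
have := sqr_ge0 (faces_mean n - harm R n); move: Hv; rewrite !ler_norml => /andP[h1 h2] h3 h4.
by apply/andP; split; lra.
Qed.

Lemma faces_var_infty (A : R) : \forall n \near \oo, A <= faces_var n.
Proof.
near=> n; have n3 : (3 <= n)%N by near: n; exact: nbhs_infty_ge.
have := faces_var_harm n3; have n0 : (0 < n)%N by exact: leq_trans n3.
have /andP[h _] := harm_ln n0; have : A + 140%:R <= ln n%:R by near: n; exact: ln_nat_infty.
by rewrite ler_norml => h1 /andP[h2 _]; lra.
Unshelve. all: by end_near. Qed.

Lemma genus_mean_cvg :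
  (n.+1%:R - faces_mean n) / 2%:R / (n%:R / 2%:R) @[n --> \oo] --> (1 : R).
Proof.
apply/cvgrPdist_le => e e0; have e2 : 0 < e / 2%:R by rewrite divr_gt0.
near=> n; have n3 : (3 <= n)%N by near: n; exact: nbhs_infty_ge.
have n0 : (0 : R) < n%:R by rewrite ltr0n; exact: leq_trans n3.
have Hm := faces_mean_harm n3; have h0 := harm_ge0 R n.
have h1 : harm R n <= e / 2%:R * n%:R by near: n; exact: harm_sublinear e2.
have h2 : 10%:R / (e / 2%:R) <= n%:R by near: n; exact: (nbhs_infty_ger (10%:R / (e / 2%:R))).
rewrite ler_pdivrMr // in h2.
have -> : 1 - (n.+1%:R - faces_mean n) / 2%:R / (n%:R / 2%:R) = (faces_mean n - 1) / n%:R.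
  by rewrite -natr1; field; rewrite gt_eqF.
rewrite normrM normfV (gtr0_norm n0) ler_pdivrMr //.
by move: Hm; rewrite !ler_norml => /andP[h3 h4]; apply/andP; split; lra.
Unshelve. all: by end_near. Qed.

Lemma genus_var_cvg :
  faces_var n / 4%:R / (4%:R^-1 * ln n%:R) @[n --> \oo] --> (1 : R).
Proof.
apply/cvgrPdist_le => e e0; near=> n.
have n3 : (3 <= n)%N by near: n; exact: nbhs_infty_ge.
have Hv := faces_var_harm n3; have n0 : (0 < n)%N by exact: leq_trans n3.
have /andP[h1 h2] := harm_ln n0.
have l1 : 1 <= ln n%:R :> R by near: n; exact: ln_nat_infty.
have l2 : 141%:R / e <= ln n%:R by near: n; exact: ln_nat_infty.
rewrite ler_pdivrMr // in l2.
have l0 : (0 : R) < ln n%:R by lra.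
have -> : 1 - faces_var n / 4%:R / (4%:R^-1 * ln n%:R) = (ln n%:R - faces_var n) / ln n%:R.
  by field; rewrite gt_eqF.
rewrite normrM normfV (gtr0_norm l0) ler_pdivrMr //.
by move: Hv; rewrite !ler_norml => /andP[h3 h4]; apply/andP; split; lra.
Unshelve. all: by end_near. Qed.

Definition std_faces n (i : nat) : R := (faces_mean n - i%:R) / Num.sqrt (faces_var n).

(** Put m = faces_mean n and del = faces_var n ^ (-1/2) in [face_mean_hinge].
    Both moments are at bounded distance of harm n, so that the bound is a
    multiple of del. *)
Lemma std_faces_hinge (z e : R) : 0 < e -> \forall n \near \oo,
  `|face_mean n (fun i => Num.max 0 (z - std_faces n i)) - normal_hinge z| <= e.
Proof.
move=> e0; have [C C0 HC] := face_mean_hinge z.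
(* The four terms of the bound are at most 140, 9, 141 and 4 times del. *)
pose A := 13%:R + C * 300%:R.
have A0 : 0 < A by rewrite ltr_wpDr ?mulr_ge0.
near=> n; have n3 : (3 <= n)%N by near: n; exact: nbhs_infty_ge.
have v1 : 1 <= faces_var n by near: n; exact: faces_var_infty.
have vA : (A / e) ^+ 2 <= faces_var n by near: n; exact: faces_var_infty.
have v0 : 0 < faces_var n by lra.
pose sg := Num.sqrt (faces_var n).
have sg0 : 0 < sg by rewrite sqrtr_gt0.
have sg2 : sg ^+ 2 = faces_var n by rewrite sqr_sqrtr // ltW.
have sg1 : 1 <= sg by rewrite -sqrtr1 ler_wsqrtr.
have Ae : 0 <= A / e by apply: divr_ge0; exact: ltW.
have sgA : A / e <= sg by rewrite -(@ler_pXn2r _ 2) ?nnegrE ?sg2 ?(ltW sg0).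
pose del := sg^-1.
have d0 : 0 < del by rewrite invr_gt0.
have d1 : del <= 1 by rewrite invf_le1.
have dsg : del * sg = 1 by rewrite mulVf // gt_eqF.
have := HC n (faces_mean n) del n3 d0 => /le_trans; apply.
have Hm := faces_mean_harm n3; have Hv := faces_var_harm n3.
set H := harm R n in Hm Hv *.
have dH : `|1 - del ^+ 2 * H| <= 140%:R * del.
  have -> : 1 - del ^+ 2 * H = del ^+ 2 * (faces_var n - H).
    by rewrite mulrBr -sg2 -exprMn dsg expr1n.
  rewrite normrM ger0_norm ?sqr_ge0 // mulrC.
  apply: ler_pM => //; first exact: sqr_ge0.
  by rewrite expr2 ler_piMl // ltW.
have dm : del * `|faces_mean n - H| <= 9%:R * del by rewrite mulrC ler_wpM2r // ltW.
have d3 : del ^+ 3 * H <= 141%:R * del.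
  have -> : del ^+ 3 * H = del * (del ^+ 2 * H) by ring.
  rewrite mulrC; apply: ler_wpM2r; first exact: ltW.
  by move: dH; rewrite ler_norml => /andP[q1 q2]; lra.
have d4 : 2%:R * (del ^+ 2 + del ^+ 3) <= 4%:R * del.
  have a2 : del ^+ 2 <= del by rewrite expr2 ler_piMl // ltW.
  have a3 : del ^+ 3 <= del by rewrite exprS (le_trans _ a2) // ler_piMl // sqr_ge0.
  by lra.
have CC : C * (`|1 - del ^+ 2 * H| + del * `|faces_mean n - H| + del ^+ 3 * H +
     2%:R * (del ^+ 2 + del ^+ 3)) <= C * (300%:R * del).
  by rewrite ler_wpM2l //; lra.
apply: (@le_trans _ _ (A * del)); first by rewrite /A; lra.
by rewrite ler_pdivrMr // mulrC -ler_pdivrMr.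
Unshelve. all: by end_near. Qed.

End Asymptotics.

(** * Integrals of functions of a discrete variable *)
Section DiscreteIntegral.
Local Open Scope ring_scope.
Variables (R : realType) (d : measure_display) (T : measurableType d) (P : probability T R).
Variables (X : {RV P >-> R}) (m : nat) (p : nat -> R).
Hypothesis pE : forall k, (k < m)%N -> P (X @^-1` [set k%:R]) = (p k)%:E.
Hypothesis p1 : \sum_(k < m) p k = 1.

Let atom (i : nat) : set T := X @^-1` [set i%:R].
Let F (i : nat) : set T := if (i < m)%N then atom i else ~` \big[setU/set0]_(j < m) atom j.

Let mF i : measurable (F i).
Proof.
rewrite /F; case: ifP => _; first exact: measurable_funPTI.
by apply: measurableC; apply: bigsetU_measurable => j _; exact: measurable_funPTI.
Qed.

Let s := iota 0 m.+1.

Let FT : \big[setU/set0]_(i <- s) F i = [set: T].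
Proof.
rewrite /s -[m.+1]addn1 iotaD big_cat /= big_seq1 add0n {2}/F ltnn.
have -> : \big[setU/set0]_(i <- iota 0 m) F i = \big[setU/set0]_(j < m) atom j.
  rewrite -(big_mkord xpredT) /index_iota subn0 [LHS]big_seq [RHS]big_seq.
  by apply: eq_bigr => i; rewrite mem_iota add0n /F => /andP[_ ->].
exact: setUv.
Qed.

Let F_triv : trivIset [set` s] F.
Proof.
move=> i j; rewrite /= !mem_iota !add0n !ltnS => /andP[_ im] /andP[_ jm] [w [Fi Fj]].
move: Fi Fj; rewrite /F; case: ltnP => im'; case: ltnP => jm' /=.
- by rewrite /atom /= => E1 E2; apply/eqP; rewrite -(eqr_nat R) -E1 -E2.
- move=> wi; rewrite -bigcup_mkord /= => H; exfalso; apply: H.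
  by exists i.
- rewrite -bigcup_mkord /= => H wj; exfalso; apply: H.
  by exists j.
- by move=> _ _; lia.
Qed.

Let integral_atoms (f : T -> R) : measurable_fun setT f ->
  (\int[P]_w (f w)%:E = \sum_(i < m) \int[P]_(w in F i) (f w)%:E + \int[P]_(w in F m) (f w)%:E)%E.
Proof.
move=> mf; have := @integral_bigsetU_EFin _ _ _ P nat F f s mF (iota_uniq _ _) F_triv.
rewrite /= FT => -> //; last exact/measurable_EFinP.
rewrite /s -[m.+1]addn1 iotaD big_cat /= big_seq1 add0n; congr (_ + _)%E.
by rewrite -(big_mkord xpredT (fun i => \int[P]_(w in F i) (f w)%:E)%E) /index_iota subn0.
Qed.

Let F_null : P (F m) = 0%E.
Proof.
have := @integral_atoms (cst 1) (measurable_cst _); rewrite /= integral_cst // mul1e.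
move=> /(etrans (esym (probability_setT P))).
rewrite (eq_bigr (fun i : 'I_m => (p i)%:E)) => [|i _]; last first.
  by rewrite integral_cst // mul1e -(pE (ltn_ord i)) /F ltn_ord.
rewrite sumEFin p1 integral_cst // mul1e.
move=> E0; have E : (1 = 1 + P (F m))%E by exact: E0.
have : P (F m) \is a fin_num by exact: fin_num_measure.
move: E; case: (P (F m)) => [u| |] // /(congr1 (@fine R)) /= E _; congr EFin.
by apply: (addrI 1); rewrite -E addr0.
Qed.

(** The atoms have total mass 1, hence a null complement. *)
Lemma discrete_integral (psi : R -> R) : measurable_fun setT (psi \o X) ->
  (\int[P]_w (psi (X w))%:E)%E = (\sum_(k < m) psi k%:R * p k)%:E.
Proof.
move=> mpsi; rewrite (integral_atoms mpsi) (null_set_integral _ _ F_null) //; last first.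
  exact/measurable_EFinP/measurable_funTS.
rewrite adde0 -sumEFin; apply: eq_bigr => k _.
rewrite (@eq_integral _ _ _ P (F k) (cst (psi k%:R)%:E)) => [|w]; last first.
  by rewrite inE /F ltn_ord /atom /= => E; rewrite E.
by rewrite integral_cst // EFinM -(pE (ltn_ord k)) /F ltn_ord.
Qed.
End DiscreteIntegral.

(** * Convergence of the distribution functions *)
Section FaceLimit.
Variable R : realType.
Local Open Scope ring_scope.

(** The indicator of the half-line below z lies between the difference quotients
    of the hinge functions on [z - eta, z] and [z, z + eta].  In the limit, these
    become slopes of [normal_hinge], which lie between values of the normal
    distribution function at points within eta of z. *)
Lemma std_faces_cdf (x : R) :
  face_mean n (fun i => (std_faces R n i <= x)%R%:R) @[n --> \oo] --> normal_cdf x.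
Proof.
apply/cvgrPdist_le => e e0; pose p : R := normal_peak 1.
(* As p bounds the density, a step of length eta changes normal_cdf by at most
   e / 2; the errors e' on the hinges, divided by eta, add up to e / 2. *)
have p0 : 0 < p by rewrite normal_peak_gt0 ?oner_neq0.
pose eta := e / 2%:R / p; have eta0 : 0 < eta by rewrite !divr_gt0.
pose e' := e * eta / 4%:R; have e'0 : 0 < e' by rewrite divr_gt0 // mulr_gt0.
have peta : p * eta = e / 2%:R by rewrite /eta mulrCA divff ?mulr1 // gt_eqF.
have Lip (y : R) : normal_cdf (y + eta) <= normal_cdf y + e / 2%:R.
  have yy : y <= y + eta by rewrite lerDl ltW.
  have [c _ E] := mean_value (@is_derive_normal_cdf R) yy.
  rewrite -lerBlDl E (_ : y + eta - y = eta); last by ring.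
  by rewrite -peta ler_wpM2r ?(ltW eta0) // normal_pdf_ub // oner_neq0.
pose hinge n (z : R) := face_mean n (fun i => Num.max 0 (z - std_faces R n i)).
have indE n (z : R) : eta * face_mean n (fun i => (std_faces R n i <= z)%R%:R) =
    face_mean n (fun i => 0 + eta * (std_faces R n i <= z)%R%:R).
  by rewrite face_mean_comb face_mean_const add0r.
have ind_ub n (z : R) : face_mean n (fun i => (std_faces R n i <= z)%R%:R) <= (hinge n (z + eta) - hinge n z) / eta.
  rewrite ler_pdivlMr // mulrC -[X in _ - X]mul1r -mulNr -face_mean_comb.
  rewrite indE; apply: face_mean_le => i.
  by case: (leP (std_faces R n i) z) => h /=; case: (leP 0 (z + eta - std_faces R n i)) => h1;
     case: (leP 0 (z - std_faces R n i)) => h2; lra.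
have ind_lb n (z : R) : (hinge n z - hinge n (z - eta)) / eta <= face_mean n (fun i => (std_faces R n i <= z)%R%:R).
  rewrite ler_pdivrMr // mulrC -[X in _ - X]mul1r -mulNr -face_mean_comb.
  rewrite indE; apply: face_mean_le => i.
  by case: (leP (std_faces R n i) z) => h /=; case: (leP 0 (z - eta - std_faces R n i)) => h1;
     case: (leP 0 (z - std_faces R n i)) => h2; lra.
near=> n.
have H1 : `|hinge n (x + eta) - normal_hinge (x + eta)| <= e' by near: n; exact: std_faces_hinge.
have H2 : `|hinge n x - normal_hinge x| <= e' by near: n; exact: std_faces_hinge.
have H3 : `|hinge n (x - eta) - normal_hinge (x - eta)| <= e' by near: n; exact: std_faces_hinge.
have [_ G1] := andP (normal_hinge_slope x eta0).
have [G2 _] := andP (normal_hinge_slope (x - eta) eta0).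
rewrite subrK in G2; have L1 := Lip x; have L2 := Lip (x - eta); rewrite subrK in L2.
have U := ind_ub n x; have V := ind_lb n x.
move: U V G1 G2; rewrite ler_pdivlMr // ler_pdivrMr // ler_pdivrMr // ler_pdivlMr //.
set F := face_mean n _ => U V G1 G2.
move: H1 H2 H3; rewrite !ler_norml => /andP[a1 a2] /andP[b1 b2] /andP[c1 c2].
have ee : e' *+ 2 = e / 2%:R * eta by rewrite /e' -mulr_natr; field.
have B1 : F * eta <= (normal_cdf x + e) * eta.
  have := ler_wpM2r (ltW eta0) L1; lra.
have B2 : (normal_cdf x - e) * eta <= F * eta.
  have := ler_wpM2r (ltW eta0) L2; lra.
by move: B1 B2; rewrite !ler_pM2r // => B1 B2; apply/andP; split; lra.
Unshelve. all: by end_near. Qed.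
End FaceLimit.

(** * The genus as a random variable *)
Section GenusVariable.
Local Open Scope ring_scope.
Variables (R : realType) (d : measure_display) (T : measurableType d) (P : probability T R).
Variables (n : nat) (X : {RV P >-> R}).
Hypothesis n3 : (3 <= n)%N.
Hypothesis XP : forall k, P (X @^-1` [set k%:R]) =
  ((genus_number (wheel n) k)%:R / (genus_poly R (wheel n)).[1])%:E.

Lemma genus_integral (psi : R -> R) : measurable_fun setT (psi \o X) ->
  (\int[P]_w (psi (X w))%:E)%E = (face_mean n (fun i => psi ((n.+1%:R - i%:R) / 2%:R)))%:E.
Proof.
have sumE (f : R -> R) : \sum_(k < n.+1) f k%:R * ((genus_number (wheel n) k)%:R / (genus_poly R (wheel n)).[1]) =
    face_mean n (fun i => f ((n.+1%:R - i%:R) / 2%:R)).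
  rewrite genus_poly_at1 // /face_mean -[RHS](congr1 (fun u => u / _) (eq_bigr _ (fun rho rP => congr1 f (genus_of_faces n3 R rP)))).
  rewrite -(sum_genus_number n3 (fun k => f k%:R) (ltnSn n)) mulr_suml.
  by apply: eq_bigr => k _; rewrite -[f _ *+ _]mulr_natr mulrA.
move=> mpsi; rewrite (@discrete_integral _ _ _ P X n.+1 (fun k => (genus_number (wheel n) k)%:R / (genus_poly R (wheel n)).[1])) ?sumE //.
apply: (etrans (esym _) (face_mean_const n (1 : R))); rewrite -(sumE (fun=> 1)).
by apply: eq_bigr => k _; rewrite mul1r.
Qed.

Lemma genus_expectation : ('E_P[X])%E = ((n.+1%:R - faces_mean R n) / 2%:R)%:E.
Proof.
rewrite unlock (genus_integral (psi := id)) //.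
congr EFin; rewrite (@eq_face_mean _ _ _ (fun i => n.+1%:R / 2%:R + - 2%:R^-1 * i%:R)).
  by rewrite (face_mean_comb _ (fun=> _)) face_mean_const /faces_mean; field.
by move=> i; field.
Qed.

Lemma genus_variance : ('V_P[X])%E = (faces_var R n / 4%:R)%:E.
Proof.
rewrite /variance covariance.unlock genus_expectation /= expectation.unlock.
pose m : R := (n.+1%:R - faces_mean R n) / 2%:R.
rewrite (genus_integral (psi := fun y => (y - m) * (y - m))); last first.
  by apply: measurable_funM; apply: measurable_funB; rewrite //; exact: (@measurable_funPT _ _ _ _ X).
congr EFin.
rewrite (@eq_face_mean _ _ _ (fun i => 0 + 4%:R^-1 * (i%:R - faces_mean R n) ^+ 2)).
  by rewrite face_mean_comb face_mean_const add0r mulrC.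
by move=> i; rewrite /m; field.
Qed.

Lemma genus_cdf (x : R) : 0 < faces_var R n ->
  cdf (standardizeRV X) x = (face_mean n (fun i => (std_faces R n i <= x)%R%:R))%:E.
Proof.
move=> v0; pose m : R := (n.+1%:R - faces_mean R n) / 2%:R.
pose s : R := Num.sqrt (faces_var R n / 4%:R).
have mA : measurable (standardize X @^-1` `]-oo, x]).
  rewrite -[X in measurable X]setTI; apply: measurable_standardize => //.
have -> : cdf (standardizeRV X) x = P (standardize X @^-1` `]-oo, x]) by [].
rewrite -[LHS](expectation_indic _ mA) expectation.unlock.
pose psi (y : R) : R := ((y - m) / s <= x)%R%:R.
have E w : \1_(standardize X @^-1` `]-oo, x]) w = psi (X w).
  rewrite indicE /psi /standardize genus_expectation genus_variance /=; congr (nat_of_bool _)%:R.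
  by apply/idP/idP; rewrite inE /= in_itv.
rewrite (@eq_integral _ _ _ P _ (fun w => (psi (X w))%:E)) => [|w _]; last by rewrite E.
rewrite genus_integral; last first.
  rewrite (_ : psi \o X = \1_(standardize X @^-1` `]-oo, x])); first exact: measurable_indic.
  by apply/funext => w; rewrite E.
congr EFin; apply: eq_face_mean => i; rewrite /psi /std_faces; congr ((_ <= _)%R : nat)%:R.
have -> : s = Num.sqrt (faces_var R n) / 2%:R.
  by rewrite /s sqrtrM ?ltW // sqrtrV // (_ : 4%:R = 2%:R ^+ 2 :> R) ?sqrtr_sqr ?normr_nat //; ring.
by rewrite /m; field; rewrite gt_eqF // sqrtr_gt0.
Qed.
End GenusVariable.

Unset Implicit Arguments.
Set Strict Implicit.
Set Printing Implicit Defensive.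

Theorem theorem1p7 (R : realType) (d : nat -> measure_display)
    (T : forall n, measurableType (d n)) (P : forall n, probability (T n) R)
    (gamma : forall n, {RV (P n) >-> R})
    (gammaP : forall n k : nat, (3 <= n)%N ->
      P n (gamma n @^-1` [set k%:R]) =
        ((genus_number (wheel n) k)%:R / (genus_poly R (wheel n)).[1])%:E) :
  [/\ cvg_in_distribution (fun n => standardizeRV (gamma n)) (normal_prob 0 1),
      fine 'E_(P n)[gamma n] / (n%:R / 2) @[n --> \oo] --> (1 : R)
    & fine 'V_(P n)[gamma n] / (4^-1 * ln n%:R) @[n --> \oo] --> (1 : R)].
Proof.
split.
- rewrite /cvg_in_distribution => /= x _; have v1 := faces_var_infty (1 : R).
  have FE : (face_mean n (fun i => (std_faces R n i <= x)%R%:R))%:E @[n --> \oo] --> normal_prob (0 : R) 1 `]-oo, x].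
    rewrite normal_cdfE; apply: cvg_EFin; last exact: std_faces_cdf.
    exact: nearW (fun=> isT).
  apply: cvg_trans (_ : _) FE.
  apply: near_eq_cvg; near=> n; have n3 : (3 <= n)%N by near: n; exact: nbhs_infty_ge.
  have v0 : 0 < faces_var R n by apply: lt_le_trans ltr01 _; near: n.
  by rewrite (genus_cdf n3 (fun k => gammaP n k n3)).
- apply: cvg_trans (_ : _) (@genus_mean_cvg R); apply: near_eq_cvg; near=> n.
  have n3 : (3 <= n)%N by near: n; exact: nbhs_infty_ge.
  by rewrite (genus_expectation n3 (fun k => gammaP n k n3)).
apply: cvg_trans (_ : _) (@genus_var_cvg R); apply: near_eq_cvg; near=> n.
have n3 : (3 <= n)%N by near: n; exact: nbhs_infty_ge.
by rewrite (genus_variance n3 (fun k => gammaP n k n3)).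
Unshelve. all: by end_near. Qed.
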